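(* Let $D$ be a division ring with center $F$ and let $N$ be a non-central almost subnormal subgroup of $D^*$. If all elements of $N$ are algebraic over $F$ of bounded degree (i.e. there is a positive integer $d$ such that every element of $N$ is algebraic over $F$ of degree at most $d$), then $D$ is centrally finite.
   Context: $D^*$ is the multiplicative group of $D$. $D$ is centrally finite if it is a finite-dimensional vector space over its center $F$. A subgroup of $D^*$ is non-central if it is not contained in $F$. A subgroup $N$ of a group $G$ is almost subnormal in $G$ if there is a finite series of subgroups $N=N_r\le N_{r-1}\le\cdots\le N_0=G$ such that for each $1\le i\le r$, either $N_i$ is normal in $N_{i-1}$ or $N_i$ has finite index in $N_{i-1}$. *)

(* Defs.v *)
From HB Require Import structures.
From mathcomp Require Import all_boot all_algebra.
From mathcomp Require Import boolp classical_sets cardinality.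

Set Implicit Arguments.
Unset Strict Implicit.
Unset Printing Implicit Defensive.

Import GRing.Theory.
Local Open Scope ring_scope.

Section UnitGroup.
Variable R : unitRingType.

(* MathComp's {unit R} is restricted to finite rings. *)
Definition unit_group := {x : R | x \is a GRing.unit}.

HB.instance Definition _ := SubChoice.on unit_group.

Implicit Types x y z : unit_group.

Definition ug_one : unit_group := Sub 1 (unitr1 R).

Fact ug_mul_subproof x y : val x * val y \is a GRing.unit.
Proof. by rewrite unitrMl (valP x, valP y). Qed.
Definition ug_mul x y : unit_group := Sub (val x * val y) (ug_mul_subproof x y).

Fact ug_inv_subproof x : (val x)^-1 \is a GRing.unit.
Proof. by rewrite unitrV (valP x). Qed.
Definition ug_inv x : unit_group := Sub (val x)^-1 (ug_inv_subproof x).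

Fact ug_mulA : associative ug_mul.
Proof. by move=> x y z; apply/val_inj; rewrite !SubK mulrA. Qed.

Fact ug_mul1 : left_id ug_one ug_mul.
Proof. by move=> x; apply/val_inj; rewrite !SubK mul1r. Qed.

Fact ug_mulr1 : right_id ug_one ug_mul.
Proof. by move=> x; apply/val_inj; rewrite !SubK mulr1. Qed.

Fact ug_mulV : left_inverse ug_one ug_inv ug_mul.
Proof. by move=> x; apply/val_inj; rewrite !SubK mulVr ?(valP x). Qed.

Fact ug_mulrV : right_inverse ug_one ug_inv ug_mul.
Proof. by move=> x; apply/val_inj; rewrite !SubK mulrV ?(valP x). Qed.

HB.instance Definition _ :=
  isGroup.Build unit_group ug_mulA ug_mul1 ug_mulr1 ug_mulV ug_mulrV.

End UnitGroup.

Section AlmostSubnormal.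
Local Open Scope group_scope.
Variable G : groupType.
Implicit Types H K : groupClosed G.

Definition normal_in H K :=
  {subset H <= K} /\ forall h k, h \in H -> k \in K -> h ^ k \in H.

Definition finite_index_in H K :=
  {subset H <= K} /\
  finite_set [set [set k * h | h in [set` H]] | k in [set` K]]%classic.

Definition almost_subnormal (N : groupClosed G) :=
  exists (r : nat) (S : nat -> groupClosed G),
    [/\ S 0%N =i predT, S r =i N &
        forall i, (i < r)%N ->
          normal_in (S i.+1) (S i) \/ finite_index_in (S i.+1) (S i)].

End AlmostSubnormal.

Section Center.
Variable D : unitRingType.

Definition center : {pred D} := [pred x | `[< forall y, GRing.comm x y >]].

(* Evaluation in the noncommutative ring D is harmless here: the coefficients
   of p and q are central. *)
Definition min_poly_over_center (x : D) (p : {poly D}) :=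
  [/\ p \is monic, p \is a polyOver center, root p x &
      forall q : {poly D},
        q \is a polyOver center -> q != 0 -> root q x -> (size p <= size q)%N].

Definition algebraic_of_degree (x : D) (n : nat) :=
  exists2 p, min_poly_over_center x p & size p = n.+1.

(* D has a finite basis as a vector space over its center. *)
Definition centrally_finite :=
  exists (n : nat) (b : 'I_n -> D), forall x : D,
    exists! c : {ffun 'I_n -> D},
      (forall i, c i \in center) /\ x = \sum_(i < n) c i * b i.

End Center.

Arguments center D : clear implicits.
Arguments centrally_finite D : clear implicits.

(* Main.v *)
Require Import Defs.
From HB Require Import structures.
From mathcomp Require Import all_boot all_algebra finfield.
From mathcomp Require Import boolp classical_sets cardinality filter.

(* Let F be the centre of D, and suppose that D is not centrally finite.

   F infinite. If H(t) is a rational function of t in F and 1 + t H(t) lies in a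
   subgroup S for generic t, call H(0) a tangent of S. Tangents pass to normal
   subgroups (delta_a h = a h a^-1 - h is a tangent when h is, for a in the
   subgroup) and, by pigeonhole, to subgroups of finite index; so for a in N and
   all u some F^*-multiple of delta_a^r u is a tangent of N. Being algebraic of
   degree <= d over F passes to the limit t -> 0 (by Amitsur's lemma on locally
   dependent operators), so delta_a^r u is algebraic of degree <= d. When a is
   separable, ad a and its powers have the same image, so all commutators [a, u]
   are algebraic of degree <= d. Differentiating the minimal polynomial of a
   commutator v of maximal degree gives an operator of finite F-rank of the form
   x |-> sum_i a_i x b_i, which must vanish; this forces a to commute with v,
   hence v = 0 and a is central. So N has no noncentral separable element, and
   in characteristic p its elements are radical over F. Then a u a^-1 = u + 1 with
   some a in N, a^p in F, and conjugation by a acts on the field generated by the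
   u + t; words evaluated in that field give (u + t + 1)^M = (u + t)^M for all t
   in F, which is absurd.

   F finite. N has finite exponent, prime to p, and a noncentral a in N satisfies
   a w = w a^j <> w a for some w. A power z of w commutes with a; by Wedderburn z
   has infinite order, so the centralizer of z has infinite centre, and the
   tangent argument applies there. *)

Set Implicit Arguments.
Unset Strict Implicit.
Unset Printing Implicit Defensive.

Import GRing.Theory.

(** * The centre as a division subring *)

Section Center.
Local Open Scope ring_scope.
Variable D : unitRingType.

Lemma centerP (x : D) : reflect (forall y, x * y = y * x) (x \in center D).
Proof. exact: asboolP. Qed.

Fact center_divring_closed : divring_closed (center D).
Proof.
split=> [|x y /centerP cx /centerP cy|x y /centerP cx /centerP cy].
- by apply/centerP=> y; rewrite mul1r mulr1.
- by apply/centerP=> z; rewrite mulrBl mulrBr cx cy.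
- apply/centerP=> z; apply: commr_sym; apply: commrM; first exact/esym/cx.
  exact/commrV/esym/cy.
Qed.
HB.instance Definition _ :=
  GRing.isDivringClosed.Build D (center D) center_divring_closed.

End Center.

(** * Linear algebra over the centre and operators of finite rank *)

Section LinearAlgebra.
Local Open Scope ring_scope.
Variable D : unitRingType.
Hypothesis divD : GRing.field_axiom D.
Local Notation F := (center D).

Lemma div_mulf_eq0 (x y : D) : x * y = 0 -> x = 0 \/ y = 0.
Proof.
move=> xy0; have [->|/divD ux] := eqVneq x 0; first by left.
by right; apply: (mulrI ux); rewrite mulr0.
Qed.

Definition span (I : finType) (e : I -> D) (y : D) :=
  exists c : I -> D, (forall i, c i \in F) /\ y = \sum_i c i * e i.

Definition finite_rank (f : D -> D) :=
  exists (I : finType) (e : I -> D), forall x, span e (f x).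

Definition indep n (v : 'I_n -> D) := forall c : 'I_n -> D,
  (forall i, c i \in F) -> \sum_i c i * v i = 0 -> forall i, c i = 0.

Definition indep_mod (I : finType) (e : I -> D) n (v : 'I_n -> D) :=
  forall c : 'I_n -> D,
  (forall i, c i \in F) -> span e (\sum_i c i * v i) -> forall i, c i = 0.

Lemma span0 (I : finType) (e : I -> D) : span e 0.
Proof.
exists (fun=> 0); split=> [i|]; first exact: rpred0.
by rewrite big1// => i _; rewrite mul0r.
Qed.

Lemma spanD (I : finType) (e : I -> D) x y :
  span e x -> span e y -> span e (x + y).
Proof.
move=> [c [cF ->]] [c' [cF' ->]]; exists (fun i => c i + c' i); split=> [i|].
  exact: rpredD.
by rewrite -big_split; apply: eq_bigr => i _; rewrite mulrDl.
Qed.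

Lemma spanZ (I : finType) (e : I -> D) a x :
  a \in F -> span e x -> span e (a * x).
Proof.
move=> aF [c [cF ->]]; exists (fun i => a * c i); split=> [i|].
  exact: rpredM.
by rewrite mulr_sumr; apply: eq_bigr => i _; rewrite mulrA.
Qed.

Lemma spanN (I : finType) (e : I -> D) x : span e x -> span e (- x).
Proof. by rewrite -mulN1r; apply: spanZ; rewrite rpredN rpred1. Qed.

Lemma spanB (I : finType) (e : I -> D) x y :
  span e x -> span e y -> span e (x - y).
Proof. by move=> ex /spanN; apply: spanD. Qed.

Lemma span_gen (I : finType) (e : I -> D) i : span e (e i).
Proof.
exists (fun j => (j == i)%:R); split=> [j|]; first exact: rpred_nat.
rewrite (bigD1 i)//= eqxx mul1r big1 ?addr0// => j /negPf->.
by rewrite mul0r.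
Qed.

Lemma span_sum (I J : finType) (e : I -> D) (c v : J -> D) :
  (forall i, c i \in F) -> (forall i, span e (v i)) -> span e (\sum_i c i * v i).
Proof.
move=> cF ev; apply: (big_ind (span e)) => [|x y|i _]; first exact: span0.
  exact: spanD.
exact: spanZ.
Qed.

Lemma spanM (I : finType) (e : I -> D) x y :
  (forall i j, span e (e i * e j)) -> span e x -> span e y -> span e (x * y).
Proof.
move=> ee [c [cF ->]] [c' [cF' ->]]; rewrite mulr_suml.
under eq_bigr do rewrite -mulrA.
apply: span_sum => // i; rewrite mulr_sumr.
rewrite (eq_bigr (fun j => c' j * (e i * e j))); first exact: span_sum.
by move=> j _; rewrite !mulrA (centerP _ (cF' j)).
Qed.

Definition ecat (I J : finType) (e : I -> D) (e' : J -> D) (k : I + J) :=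
  match k with inl i => e i | inr j => e' j end.

Lemma span_catl (I J : finType) (e : I -> D) (e' : J -> D) x :
  span e x -> span (ecat e e') x.
Proof.
move=> [c [cF ->]]; exists (ecat c (fun=> 0)); split=> [[i|j]|] //=.
  exact: rpred0.
by rewrite big_sumType /= [X in _ + X]big1 ?addr0// => i _; rewrite mul0r.
Qed.

Lemma span_catr (I J : finType) (e : I -> D) (e' : J -> D) x :
  span e' x -> span (ecat e e') x.
Proof.
move=> [c [cF ->]]; exists (ecat (fun=> 0) c); split=> [[i|j]|] //=.
  exact: rpred0.
by rewrite big_sumType /= [X in X + _]big1 ?add0r// => i _; rewrite mul0r.
Qed.

Lemma finite_rankB f g :
  finite_rank f -> finite_rank g -> finite_rank (fun x => f x - g x).
Proof.
move=> [I [e ef]] [J [e' eg]]; exists (I + J)%type, (ecat e e') => x.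
by apply: spanB; [apply: span_catl|apply: span_catr].
Qed.

Lemma finite_rank_mull a f : finite_rank f -> finite_rank (fun x => a * f x).
Proof.
move=> [I [e ef]]; exists I, (fun i => a * e i) => x.
have [c [cF ->]] := ef x; exists c; split=> //.
rewrite mulr_sumr; apply: eq_bigr => i _.
by rewrite !mulrA (centerP _ (cF i)).
Qed.

Lemma finite_rank_mulr a f : finite_rank f -> finite_rank (fun x => f x * a).
Proof.
move=> [I [e ef]]; exists I, (fun i => e i * a) => x.
have [c [cF ->]] := ef x; exists c; split=> //.
by rewrite mulr_suml; apply: eq_bigr => i _; rewrite mulrA.
Qed.

Lemma finite_rank_comp f g : finite_rank f -> finite_rank (f \o g).
Proof. by move=> [I [e ef]]; exists I, e => x /=. Qed.

Lemma spanning_drop n (e : 'I_n.+1 -> D) :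
  (forall x, span e x) -> ~ indep e ->
  exists e' : 'I_n -> D, forall x, span e' x.
Proof.
move=> spe /existsNP[c /not_implyP[cF /not_implyP[ce /existsNP[j /eqP cj0]]]].
exists (e \o lift j) => x; have [c' [cF' ->]] := spe x.
have uj := divD cj0.
have ej : e j = - \sum_i ((c j)^-1 * c (lift j i)) * e (lift j i).
  apply: (mulrI uj); move: ce; rewrite (bigD1_ord j)//= mulrN => /eqP.
  rewrite addr_eq0 => /eqP->; congr (- _); rewrite mulr_sumr.
  by apply: eq_bigr => i _; rewrite !mulrA divrr// mul1r.
rewrite (bigD1_ord j)//=; apply: spanD; last first.
  by exists (c' \o lift j); split=> //= i.
apply: spanZ => //; rewrite ej; apply: spanN.
exists (fun i => (c j)^-1 * c (lift j i)); split=> // i.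
by apply: rpredM => //; rewrite rpredV.
Qed.

Lemma centrally_finite_spanning n (e : 'I_n -> D) :
  (forall x, span e x) -> centrally_finite D.
Proof.
elim: n e => [|n IHn] e spe; have [ie|nie] := pselect (indep e).
- exists 0, e => x; have [c [cF xE]] := spe x.
  exists [ffun i => c i]; split=> [|c' _]; last by apply/ffunP; case.
  by split=> [[]//|]; rewrite xE !big_ord0.
- by case: nie => c _ _ [].
- exists n.+1, e => x; have [c [cF xE]] := spe x.
  exists [ffun i => c i]; split=> [|c' [cF' xE']].
    split=> [i|]; first by rewrite ffunE.
    by rewrite xE; apply: eq_bigr => i _; rewrite ffunE.
  apply/ffunP => i; rewrite ffunE; apply/eqP; rewrite -subr_eq0; apply/eqP.
  apply: (ie (fun i => c i - c' i)) => [j|]; first exact: rpredB.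
  under eq_bigr do rewrite mulrBl.
  by rewrite sumrB -xE -xE' subrr.
- by have [e' /IHn] := spanning_drop spe nie.
Qed.

Lemma finite_rank_id : finite_rank id -> centrally_finite D.
Proof.
move=> [I [e spe]].
apply: (@centrally_finite_spanning _ (e \o enum_val)) => x.
have [c [cF ->]] := spe x; exists (c \o enum_val); split=> [i|].
  exact: cF.
by rewrite (reindex (@enum_val I I))//=; apply/onW_bij/enum_val_bij.
Qed.

Hypothesis ncfD : ~ centrally_finite D.

(* With the first coefficient normalised to 1, x |-> T(y x) - y T(x) is a
   shorter operator of finite rank; hence it vanishes and T(y) = y T(1). *)
Lemma finite_rank_op n (a b : 'I_n -> D) :
  finite_rank (fun x => \sum_i a i * x * b i) ->
  forall x, \sum_i a i * x * b i = 0.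
Proof.
elim: n a b => [|n IHn] a b; first by move=> _ x; rewrite big_ord0.
move=> fr; have [a0|/divD ua] := eqVneq (a ord0) 0.
  have E x : \sum_i a i * x * b i
           = \sum_i a (lift ord0 i) * x * b (lift ord0 i).
    by rewrite big_ord_recl a0 !mul0r add0r.
  move=> x; rewrite E; apply: (IHn (a \o lift ord0) (b \o lift ord0)).
  by move: fr; under [fun x => _]eq_fun => y do rewrite E.
pose a' i := (a ord0)^-1 * a i.
pose T x := \sum_i a' i * x * b i.
have aT x : \sum_i a i * x * b i = a ord0 * T x.
  rewrite mulr_sumr; apply: eq_bigr => i _.
  by rewrite !mulrA divrr// mul1r.
have frT : finite_rank T.
  have := finite_rank_mull (a ord0)^-1 fr.
  by under [fun x => _]eq_fun => y do rewrite aT mulrA mulVr// mul1r.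
have Tl y x : T (y * x) = y * T x.
  apply/eqP; rewrite -subr_eq0; apply/eqP.
  pose a'' i := a' (lift ord0 i) * y - y * a' (lift ord0 i).
  have E z : T (y * z) - y * T z = \sum_i a'' i * z * b (lift ord0 i).
    rewrite /T !big_ord_recl /= mulrDr opprD addrACA /a' mulVr// !mul1r.
    rewrite mulrA subrr add0r mulr_sumr -sumrB; apply: eq_bigr => i _.
    by rewrite /a'' /a' !mulrBl !mulrA.
  rewrite E; apply: (IHn a'' (b \o lift ord0)).
  under [fun x => _]eq_fun => z do rewrite -E.
  apply: finite_rankB; last exact: finite_rank_mull.
  exact: (@finite_rank_comp T (fun z => y * z)).
have T1 x : T x = x * T 1 by rewrite -Tl mulr1.
have [T10|/divD uT] := eqVneq (T 1) 0.
  by move=> x; rewrite aT T1 T10 !mulr0.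
case: ncfD; apply: finite_rank_id.
have := finite_rank_mulr (T 1)^-1 frT.
by under [fun x => _]eq_fun => x do rewrite T1 mulrK//.
Qed.

(** The shortening trick again: with a_0 normalised to 1, T(y x) - y T(x) has one term fewer, so
    every a_i is central by induction; then T(1) = 0 is a relation between the independent b_i. *)
Lemma indep_op n (a b : 'I_n -> D) :
  indep b -> (forall x, \sum_i a i * x * b i = 0) -> forall i, a i = 0.
Proof.
elim: n a b => [|n IHn] a b; first by move=> _ _ [].
move=> ib ab0.
have ib' : indep (b \o lift ord0).
  move=> c cF cb i.
  pose c' j := if unlift ord0 j is Some k then c k else 0.
  have c'E k : c' (lift ord0 k) = c k by rewrite /c' liftK.
  rewrite -c'E; apply: ib => [j|].
    by rewrite /c'; case: unlift => [k|]; rewrite ?cF ?rpred0.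
  rewrite big_ord_recl {1}/c' unlift_none mul0r add0r -[RHS]cb.
  by apply: eq_bigr => k _; rewrite c'E.
have a00 : a ord0 = 0.
  apply/eqP/negP => /negP /divD ua.
  pose a' i := (a ord0)^-1 * a i.
  have a'b0 x : \sum_i a' i * x * b i = 0.
    transitivity ((a ord0)^-1 * \sum_i a i * x * b i); last by rewrite ab0 mulr0.
    rewrite mulr_sumr.
    by apply: eq_bigr => i _; rewrite !mulrA.
  have ca' i : a' i \in F.
    case: (unliftP ord0 i) => [j ->|->]; last by rewrite /a' mulVr// rpred1.
    apply/centerP => y; apply/eqP; rewrite -subr_eq0; apply/eqP.
    apply: (IHn (fun j => a' (lift ord0 j) * y - y * a' (lift ord0 j)) _ ib').
    move=> x.
    transitivity (\sum_i a' i * (y * x) * b i - y * \sum_i a' i * x * b i).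
      rewrite !big_ord_recl mulrDr opprD addrACA.
      rewrite [X in _ = X + _](_ : _ = 0) ?add0r.
        rewrite mulr_sumr -sumrB; apply: eq_bigr => k _.
        by rewrite !mulrBl !mulrA.
      by rewrite /a' mulVr// !mul1r mulrA subrr.
    by rewrite !a'b0 mulr0 subrr.
  have a'b : \sum_i a' i * b i = 0.
    by rewrite -[RHS](a'b0 1); apply: eq_bigr => i _; rewrite mulr1.
  have /eqP := ib a' ca' a'b ord0.
  by rewrite /a' mulVr// oner_eq0.
move=> i; case: (unliftP ord0 i) => [j ->|->//].
apply: (IHn (a \o lift ord0) _ ib') => x; rewrite -[RHS](ab0 x).
by rewrite big_ord_recl a00 !mul0r add0r.
Qed.

(** Amitsur's lemma in contrapositive form: operators whose values are everywhere dependent modulo a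
    finite-dimensional space have a nontrivial combination of finite rank. A combination S is read
    off at one point x0 and shown to land in the span of [e]. *)
Lemma amitsur n (T : 'I_n -> D -> D) :
  (forall i x y, T i (x + y) = T i x + T i y) ->
  (forall c : 'I_n -> D, (forall i, c i \in F) ->
     finite_rank (fun x => \sum_i c i * T i x) -> forall i, c i = 0) ->
  forall (I : finType) (e : I -> D), exists x, indep_mod e (T ^~ x).
Proof.
elim: n T => [|n IHn] T TD Tindep I e.
  by exists 0 => c _ _ [].
pose T' i := T (lift ord0 i).
have IH (J : finType) (e' : J -> D) : exists x, indep_mod e' (T' ^~ x).
  apply: IHn => [i x y|c cF fr i]; first exact: TD.
  pose c' j := if unlift ord0 j is Some k then c k else 0.
  have c'E k : c' (lift ord0 k) = c k by rewrite /c' liftK.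
  rewrite -c'E; apply: Tindep => [j|].
    by rewrite /c'; case: unlift => [k|]; rewrite ?cF ?rpred0.
  move: fr; congr finite_rank; apply/funext => x.
  rewrite big_ord_recl {1}/c' unlift_none mul0r add0r.
  by apply: eq_bigr => k _; rewrite c'E.
apply: contrapT => /forallNP nix.
have dep x : indep_mod e (T' ^~ x) ->
    exists d : 'I_n -> D, (forall i, d i \in F) /\
      span e (T ord0 x + \sum_i d i * T' i x).
  move=> ix; move: (nix x) => /existsNP[c /not_implyP[cF /not_implyP[ce]]].
  move=> /existsNP[j cj].
  have uc0 : c ord0 \is a GRing.unit.
    apply: divD; apply/eqP => c0; apply: cj.
    case: (unliftP ord0 j) => [k ->|->//].
    apply: (ix (c \o lift ord0)) => [i|]; first exact: cF.
    by move: ce; rewrite big_ord_recl c0 mul0r add0r.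
  exists (fun i => (c ord0)^-1 * c (lift ord0 i)); split=> [i|].
    by rewrite rpredM ?rpredV.
  have cVF : (c ord0)^-1 \in F by rewrite rpredV.
  have := spanZ cVF ce.
  rewrite big_ord_recl mulrDr mulrA mulVr// mul1r mulr_sumr.
  by under eq_bigr do rewrite mulrA.
have [x0 ix0] := IH I e; have [d [dF Sx0]] := dep x0 ix0.
pose S x := T ord0 x + \sum_i d i * T' i x.
have SD x y : S (x + y) = S x + S y.
  rewrite /S TD addrACA -big_split; congr (_ + _); apply: eq_bigr => i _ /=.
  by rewrite -mulrDr -TD.
pose e' := ecat e (T' ^~ x0).
(* For x generic relative to x0, compare the relations at x and x + x0: independence modulo e'
   forces h = g, and independence at x0 then forces h = 0. *)
have Se x : indep_mod e' (T' ^~ x) -> span e (S x).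
  move=> ix.
  have ixe : indep_mod e (T' ^~ x).
    by move=> c cF ce; apply: ix => //; apply: span_catl.
  have ixx : indep_mod e (T' ^~ (x + x0)).
    move=> c cF ce; apply: ix => //.
    have -> : \sum_i c i * T' i x
            = \sum_i c i * T' i (x + x0) - \sum_i c i * T' i x0.
      by rewrite -sumrB; apply: eq_bigr => i _; rewrite -mulrBr /T' TD addrK.
    apply: spanB; first exact: span_catl.
    by apply: span_sum => // i; apply: span_catr; apply: (span_gen (T' ^~ x0)).
  have [d1 [d1F S1]] := dep _ ixe; have [d2 [d2F S2]] := dep _ ixx.
  pose g i := d1 i - d i; pose h i := d2 i - d i.
  have gF i : g i \in F by rewrite rpredB.
  have hF i : h i \in F by rewrite rpredB.
  have {}S1 : span e (S x + \sum_i g i * T' i x).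
    move: S1; rewrite /S -addrA -big_split /=; congr (span e (_ + _)).
    by apply: eq_bigr => i _; rewrite -mulrDl /g [d i + _]addrC subrK.
  have {}S2 : span e (S (x + x0) + \sum_i h i * T' i (x + x0)).
    move: S2; rewrite /S -addrA -big_split /=; congr (span e (_ + _)).
    by apply: eq_bigr => i _; rewrite -mulrDl /h [d i + _]addrC subrK.
  have S3 : span e (\sum_i (h i - g i) * T' i x + \sum_i h i * T' i x0).
    have := spanB (spanB S2 S1) Sx0; congr span; rewrite -/(S x0) SD.
    rewrite [in LHS](eq_bigr (fun i => h i * T' i x + h i * T' i x0)); last first.
      by move=> i _; rewrite -mulrDr -TD.
    rewrite [in RHS](eq_bigr (fun i => h i * T' i x - g i * T' i x)); last first.
      by move=> i _; rewrite mulrBl.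
    rewrite big_split sumrB /=.
    set A := S x; set B := S x0; set P := \sum_i h i * T' i x.
    set Q := \sum_i h i * T' i x0; set R := \sum_i g i * T' i x.
    rewrite (addrAC A B) [LHS]addrAC addrK opprD addrACA subrr add0r.
    by rewrite [LHS]addrAC.
  have gh i : h i = g i.
    apply/eqP; rewrite -subr_eq0; apply/eqP.
    apply: (ix (fun i => h i - g i)) => [k|]; first by rewrite rpredB.
    have -> : \sum_i (h i - g i) * T' i x
       = \sum_i (h i - g i) * T' i x + \sum_i h i * T' i x0
         - \sum_i h i * T' i x0 by rewrite addrK.
    apply: spanB; first exact: span_catl.
    by apply: span_sum => // k; apply: span_catr; apply: (span_gen (T' ^~ x0)).
  have h0 : forall i, h i = 0.
    apply: ix0 => //; move: S3; congr span; rewrite big1 ?add0r// => i _.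
    by rewrite gh subrr mul0r.
  move: S1; congr span; rewrite big1 ?addr0// => i _.
  by rewrite -gh h0 mul0r.
have frS : finite_rank S.
  (* An arbitrary y is the difference of x + y and x, to both of which [Se] applies. *)
  exists I, e => y; have [x ix] := IH _ (ecat e' (T' ^~ y)).
  have -> : S y = S (x + y) - S x by rewrite SD addrAC subrr add0r.
  apply: spanB; apply: Se => c cF ce; apply: ix => //; last exact: span_catl.
  have -> : \sum_i c i * T' i x
          = \sum_i c i * T' i (x + y) - \sum_i c i * T' i y.
    by rewrite -sumrB; apply: eq_bigr => i _; rewrite -mulrBr /T' TD addrK.
  apply: spanB; first exact: span_catl.
  by apply: span_sum => // i; apply: span_catr; apply: (span_gen (T' ^~ y)).
pose c j := if unlift ord0 j is Some k then d k else 1.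
have c0 : c ord0 = 0.
  apply: Tindep => [j|].
    by rewrite /c; case: unlift => [k|]; rewrite ?dF ?rpred1.
  move: frS; congr finite_rank; apply/funext => x.
  rewrite big_ord_recl {1}/c unlift_none mul1r; congr (_ + _).
  by apply: eq_bigr => k _; rewrite /c liftK.
by move: c0 (oner_neq0 D); rewrite /c unlift_none => ->; rewrite eqxx.
Qed.

End LinearAlgebra.

(** * The Ore condition for polynomials over a division ring *)

Section Ore.
Local Open Scope ring_scope.
Variable D : unitRingType.
Hypothesis divD : GRing.field_axiom D.
Implicit Types P Q A B : {poly D}.

Lemma div_polyM_eq0 P Q : P * Q = 0 -> P = 0 \/ Q = 0.
Proof.
move=> /eqP PQ0; have [->|P0] := eqVneq P 0; first by left.
right; apply/eqP/negPn/negP => Q0; move: PQ0; apply/negP.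
rewrite -size_poly_gt0 size_proper_mul.
  move: P0 Q0; rewrite -!size_poly_gt0.
  by case: (size P) => // n; case: (size Q) => // m; rewrite addnS.
apply/eqP => /(div_mulf_eq0 divD)[] /eqP; rewrite lead_coef_eq0.
  by rewrite (negPf P0).
by rewrite (negPf Q0).
Qed.

Lemma poly_lead_reduce P Q : Q != 0 -> P != 0 -> (size Q <= size P)%N ->
  exists B, (size (P - Q * B)%R < size P)%N.
Proof.
move=> Q0 P0 sQP; pose k := (size P - size Q)%N.
have uQ : lead_coef Q \is a GRing.unit by apply: divD; rewrite lead_coef_eq0.
exists (((lead_coef Q)^-1 * lead_coef P)%:P * 'X^k).
have sP : (0 < size P)%N by rewrite size_poly_gt0.
rewrite -[ltnRHS](prednK sP) ltnS; apply/leq_sizeP => j le_j.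
have sQ : (0 < size Q)%N by rewrite size_poly_gt0.
rewrite mulrA coefB coefMXn coefMC.
have -> : (j < k)%N = false.
  apply/negbTE; rewrite -leqNgt (leq_trans _ le_j)// /k.
  by rewrite -ltnS prednK// ltn_subrL sQ.
move: le_j; rewrite leq_eqVlt => /predU1P[<-|lt_j].
  have -> : ((size P).-1 - k)%N = (size Q).-1.
    by rewrite -!subn1 subnAC subKn.
  by rewrite -!lead_coefE mulrA divrr// mul1r subrr.
have lj : (size P <= j)%N by move: lt_j; rewrite prednK.
rewrite !nth_default ?mul0r ?subr0//.
by rewrite leq_subRL ?/k ?subnK// (leq_trans _ lj)// leq_subr.
Qed.

(** Euclidean descent: subtracting a right multiple of the smaller polynomial lowers the total size,
    and a common right multiple for the remainder yields one for the pair. *)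
Lemma ore_poly P Q : P != 0 -> Q != 0 -> exists A B, A != 0 /\ P * A = Q * B.
Proof.
have [n le_n] := ubnP (size P + size Q)%N.
elim: n => // n IHn in P Q le_n *.
wlog sQP : P Q le_n / (size Q <= size P)%N => [wlog_le P0 Q0|P0 Q0].
  have [/wlog_le|/ltnW] := leqP (size Q) (size P); first exact.
  rewrite addnC in le_n; move=> /(wlog_le Q P le_n)[//|//|A [B [A0 QA]]].
  exists B, A; split=> //; apply/eqP => B0; move: QA.
  rewrite B0 mulr0 => /div_polyM_eq0[] /eqP; first by rewrite (negPf Q0).
  by rewrite (negPf A0).
have [C ltC] := poly_lead_reduce Q0 P0 sQP.
have [/eqP|PC0] := eqVneq (P - Q * C) 0.
  rewrite subr_eq0 => /eqP PC; exists 1, C.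
  by rewrite oner_neq0 mulr1.
have [|A [B [A0 AB]]] := IHn _ Q _ PC0 Q0.
  by rewrite -ltnS (leq_trans _ le_n)// ltnS ltn_add2r.
exists A, (B + C * A); split=> //.
by rewrite mulrDr -AB mulrBl mulrA subrK.
Qed.

Lemma horner0M P Q : (P * Q).[0] = P.[0] * Q.[0].
Proof. by rewrite hornerM_comm// /comm_poly mulr0 mul0r. Qed.

Lemma poly_root0 P : P.[0] = 0 -> exists Q, P = Q * 'X.
Proof.
by move/rootP/factor_theorem => [Q]; rewrite polyC0 subr0; exists Q.
Qed.

(** If A(0) = 0 then Q(0) B(0) = 0, hence B(0) = 0; both A and B are divisible by X, which is
    cancelled until A(0) is nonzero. *)
Lemma ore_poly0 P Q : Q.[0] != 0 -> exists A B, A.[0] != 0 /\ P * A = Q * B.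
Proof.
move=> Q00; have Q0 : Q != 0 by apply: contraNneq Q00 => ->; rewrite horner0.
have [->|P0] := eqVneq P 0.
  by exists 1, 0; rewrite hornerC oner_neq0 mul0r mulr0.
have [A [B []]] := ore_poly P0 Q0.
have [n le_n] := ubnP (size A).
elim: n => // n IHn in A B le_n * => A0 PA.
have [A00|] := eqVneq A.[0] 0; last by exists A, B.
have B00 : B.[0] = 0.
  have: Q.[0] * B.[0] = 0 by rewrite -horner0M -PA horner0M A00 mulr0.
  by move=> /(div_mulf_eq0 divD)[] // /eqP; rewrite (negPf Q00).
have [A' EA] := poly_root0 A00; have [B' EB] := poly_root0 B00.
have A'0 : A' != 0 by apply: contraNneq A0 => A'0; rewrite EA A'0 mul0r.
apply: (IHn A' B') => //.
  by move: le_n; rewrite EA size_mulX.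
have: (P * A' - Q * B') * 'X = 0 by rewrite mulrBl -!mulrA -EA -EB PA subrr.
move=> /div_polyM_eq0[] /eqP; last by rewrite polyX_eq0.
by rewrite subr_eq0 => /eqP.
Qed.

End Ore.

(** * Rational functions of a generic central parameter *)

(* The sets in [U] are those of "generic" central elements; [f] is regular when
   it is generically a right fraction P(t) Q(t)^-1 with Q(0) <> 0. *)
Section Regular.
Local Open Scope ring_scope.
Local Open Scope classical_set_scope.
Variable D : unitRingType.
Hypothesis divD : GRing.field_axiom D.
Local Notation F := (center D).
Variable U : set_system D.
Hypothesis PU : ProperFilter U.
Hypothesis UF : U [set t | t \in F].
Hypothesis Une : forall c, U [set t | t <> c].

Lemma hornerM_central (P Q : {poly D}) t :
  t \in F -> (P * Q).[t] = P.[t] * Q.[t].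
Proof. by move=> /centerP tF; rewrite hornerM_comm// /comm_poly tF. Qed.

(** Only central roots matter; each splits off a right factor X - c, and generic t avoid c. *)
Lemma near_nonroot (P : {poly D}) : P != 0 -> U [set t | P.[t] <> 0].
Proof.
have [n le_n] := ubnP (size P); elim: n => // n IHn in P le_n *.
move=> P0; have [[c [cF /factor_theorem[Q EQ]]]|nr] :=
    pselect (exists c, c \in F /\ root P c).
  have Q0 : Q != 0 by apply: contraNneq P0 => Q0; rewrite EQ Q0 mul0r.
  have sQ : (size Q < n)%N.
    by move: le_n; rewrite EQ size_Mmonic ?monicXsubC// size_XsubC addn2.
  apply: filterS3 UF (Une c) (IHn Q sQ Q0) => t /= tF tc Qt.
  rewrite EQ hornerM_central// hornerXsubC => /(div_mulf_eq0 divD)[//|/eqP].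
  by rewrite subr_eq0 => /eqP.
by apply: filterS UF => t /= tF /rootP Pt; apply: nr; exists t.
Qed.

Definition regular (f : D -> D) := exists P Q : {poly D},
  [/\ Q.[0] != 0, f 0 * Q.[0] = P.[0] & U [set t | f t * Q.[t] = P.[t]]].

Lemma regular_cst a : regular (fun=> a).
Proof.
exists a%:P, 1; rewrite !hornerE ?mulr1 oner_neq0; split=> //.
by apply: filterS UF => t _ /=; rewrite !hornerE ?mulr1.
Qed.

Lemma regular_id : regular id.
Proof.
exists 'X, 1; rewrite !hornerE ?mulr1 oner_neq0; split=> //.
by apply: filterS UF => t _ /=; rewrite !hornerE ?mulr1.
Qed.

(** [ore_poly0] provides a common denominator Q1 B = Q2 A with A(0) nonzero, so that it does not
    vanish at 0. *)
Lemma regularD f g : regular f -> regular g -> regular (fun t => f t + g t).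
Proof.
move=> [P1 [Q1 [Q10 f0 ft]]] [P2 [Q2 [Q20 g0 gt]]].
have [A [B [A0 AB]]] := ore_poly0 divD Q2 Q10.
exists (P1 * B + P2 * A), (Q2 * A); split.
- rewrite horner0M; apply/eqP => /(div_mulf_eq0 divD)[] /eqP.
    exact/negP.
  exact/negP.
- rewrite mulrDl {1}AB hornerD !horner0M !mulrA f0 g0//.
- apply: filterS3 UF ft gt => t /= tF ft gt.
  by rewrite mulrDl {1}AB hornerD !hornerM_central// !mulrA ft gt.
Qed.

Lemma regularM f g : regular f -> regular g -> regular (fun t => f t * g t).
Proof.
move=> [P1 [Q1 [Q10 f0 ft]]] [P2 [Q2 [Q20 g0 gt]]].
have [A [B [A0 AB]]] := ore_poly0 divD P2 Q10.
exists (P1 * B), (Q2 * A); split.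
- rewrite horner0M; apply/eqP => /(div_mulf_eq0 divD)[] /eqP.
    exact/negP.
  exact/negP.
- by rewrite !horner0M mulrA -(mulrA (f 0)) g0 -mulrA -(horner0M P2) AB horner0M
    mulrA f0.
- apply: filterS3 UF ft gt => t /= tF ft gt.
  by rewrite !hornerM_central// mulrA -(mulrA (f t)) gt -mulrA
    -(hornerM_central P2)// AB hornerM_central// mulrA ft.
Qed.

Lemma regularN f : regular f -> regular (fun t => - f t).
Proof.
move=> /(regularM (regular_cst (-1))); congr regular.
by apply/funext => t; rewrite mulN1r.
Qed.

Lemma regularB f g : regular f -> regular g -> regular (fun t => f t - g t).
Proof. by move=> rf /regularN; apply: regularD. Qed.

Lemma regularX f n : regular f -> regular (fun t => f t ^+ n).
Proof.
move=> rf; elim: n => [|n IHn]; first exact: (regular_cst 1).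
under [fun t => _]eq_fun => t do rewrite exprS.
exact: regularM.
Qed.

Lemma regular_sum n (f : 'I_n -> D -> D) :
  (forall i, regular (f i)) -> regular (fun t => \sum_i f i t).
Proof.
elim: n f => [|n IHn] f rf.
  under [fun t => _]eq_fun => t do rewrite big_ord0.
  exact: (regular_cst 0).
under [fun t => _]eq_fun => t do rewrite big_ord_recl.
by apply: regularD => //; apply: (IHn (fun i => f (lift ord0 i))).
Qed.

Lemma regular_near f : regular f -> f 0 != 0 -> U [set t | f t <> 0].
Proof.
move=> [P [Q [Q0 f0 ft]]] f00.
have P0 : P != 0.
  apply/eqP => P0; move: f0; rewrite P0 horner0.
  by move=> /(div_mulf_eq0 divD)[] /eqP; apply/negP.
apply: filterS2 ft (near_nonroot P0) => t /= <- Pt ft0.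
by apply: Pt; rewrite ft0 mul0r.
Qed.

Lemma regularV f : regular f -> f 0 != 0 -> regular (fun t => (f t)^-1).
Proof.
move=> rf f00; have nf := regular_near rf f00.
case: rf => P [Q [Q0 f0 ft]].
exists Q, P; split.
- rewrite -f0; apply/eqP => /(div_mulf_eq0 divD)[] /eqP; apply/negP => //.
- by rewrite -f0 mulrA mulVr ?mul1r//; apply: divD.
- apply: filterS2 ft nf => t /= <- /eqP ft0.
  by rewrite mulrA mulVr ?mul1r//; apply: divD.
Qed.

Hypothesis ncfD : ~ centrally_finite D.

(** After division by f_0, dependence of 1 and the g_i(t) makes the commutators [g_i(t), x]
    dependent for every x. If the f_i(0) were independent, Amitsur's lemma would give an x with the
    [g_i(0), x] independent, against induction with one function fewer. *)
Lemma limit_dep n (f : 'I_n -> D -> D) :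
  (forall i, regular (f i)) -> U [set t | ~ indep (f ^~ t)] ->
  ~ indep (f ^~ 0).
Proof.
elim: n f => [|n IHn] f rf Uf if0.
  by have [t /= nit] := filter_ex Uf; apply: nit => c _ _ [].
have f00 : f ord0 0 != 0.
  apply/eqP => f00.
  have := if0 (fun j => (j == ord0)%:R); rewrite big_ord_recl f00 mulr0 add0r.
  rewrite big1 => [|i _]; last by rewrite mul0r.
  by move=> /(_ (fun i => rpred_nat _ _) erefl ord0)/eqP; rewrite oner_eq0.
have uf0 := divD f00.
pose g i t := (f ord0 t)^-1 * f (lift ord0 i) t.
have rg i : regular (g i) by apply: regularM => //; apply: regularV.
have [||x ix] := @amitsur D divD n (fun i y => g i 0 * y - y * g i 0) _ _
    'I_0 (fun=> 0).
- by move=> i x y; rewrite mulrDr mulrDl opprD addrACA.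
- move=> c cF fr.
  pose s := \sum_i c i * g i 0.
  have E y : \sum_i c i * (g i 0 * y - y * g i 0) = s * y - y * s.
    rewrite mulr_suml mulr_sumr -sumrB; apply: eq_bigr => i _.
    by rewrite mulrBr !mulrA (centerP _ (cF i) y).
  have sF : s \in F.
    apply/centerP => y; apply/eqP; rewrite -subr_eq0; apply/eqP.
    have := @finite_rank_op _ divD ncfD 2
      (fun i => if i == ord0 then s else -1)
      (fun i => if i == ord0 then 1 else s).
    have E2 z : \sum_(i < 2) (if i == ord0 then s else -1) * z *
        (if i == ord0 then 1 else s) = s * z - z * s.
      by rewrite !big_ord_recl big_ord0 /= mulr1 addr0 mulN1r mulNr.
    move=> H; rewrite -E2; apply: H; move: fr; congr finite_rank.
    by apply/funext => z; rewrite E2 E.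
  pose c' j := if unlift ord0 j is Some k then c k else - s.
  have c'E k : c' (lift ord0 k) = c k by rewrite /c' liftK.
  move=> i; rewrite -c'E; apply: if0 => [j|].
    by rewrite /c'; case: unlift => [k|]; rewrite ?cF ?rpredN.
  rewrite big_ord_recl {1}/c' unlift_none (centerP _ _ _); last by rewrite rpredN.
  rewrite mulrN mulr_sumr addrC; apply/eqP; rewrite subr_eq0; apply/eqP.
  apply: eq_bigr => k _; rewrite c'E (mulrA (f ord0 0)).
  by rewrite -(centerP _ (cF k) (f ord0 0)) -(mulrA (c k)) /g mulVKr.
apply: (IHn (fun i t => g i t * x - x * g i t)).
- by move=> i; apply: regularB; apply: regularM => //; apply: regular_cst.
- apply: filterS2 (regular_near (rf ord0) f00) Uf => t /= /eqP f0t nif ig.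
  have uft := divD f0t.
  apply: nif => c cF ce.
  have E : c ord0 + \sum_i c (lift ord0 i) * g i t = 0.
    transitivity ((f ord0 t)^-1 * \sum_i c i * f i t); last by rewrite ce mulr0.
    rewrite big_ord_recl mulrDr mulrA -(centerP _ (cF ord0)) -mulrA.
    rewrite mulVr// mulr1 mulr_sumr; congr (_ + _).
    by apply: eq_bigr => i _; rewrite !mulrA (centerP _ (cF _)).
  have cl i : c (lift ord0 i) = 0.
    apply: (ig (c \o lift ord0)) => [j|]; first exact: cF.
    have /centerP/(_ x)/eqP : \sum_i c (lift ord0 i) * g i t \in F.
      by move/eqP: E; rewrite addrC addr_eq0 => /eqP->; rewrite rpredN.
    rewrite -subr_eq0 => /eqP; apply: etrans.
    rewrite mulr_suml mulr_sumr -sumrB; apply: eq_bigr => j _ /=.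
    by rewrite mulrBr !mulrA (centerP _ (cF (lift ord0 j)) x).
  move=> i; case: (unliftP ord0 i) => [j ->//|->].
  by move: E; rewrite big1 ?addr0// => j _; rewrite cl mul0r.
- move=> c cF ce; apply: ix => //.
  by rewrite ce; apply: span0.
Qed.

End Regular.

(** * Inner derivations and separability *)

Section InnerDerivations.
Local Open Scope ring_scope.
Variable D : unitRingType.
Local Notation F := (center D).
Implicit Types a b u v x : D.

Definition ad a u := a * u - u * a.

Definition delta a u := a * u * a^-1 - u.

Lemma adD a u v : ad a (u + v) = ad a u + ad a v.
Proof. by rewrite /ad mulrDr mulrDl opprD addrACA. Qed.

Lemma ad0 a : ad a 0 = 0.
Proof. by rewrite /ad mulr0 mul0r subrr. Qed.

Lemma ad_sum a n (v : 'I_n -> D) : ad a (\sum_i v i) = \sum_i ad a (v i).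
Proof. by rewrite /ad mulr_sumr mulr_suml sumrB. Qed.

Lemma adMr a u b : GRing.comm a b -> ad a (u * b) = ad a u * b.
Proof. by move=> ab; rewrite /ad mulrBl -!mulrA ab. Qed.

Lemma adZ a t u : t \in F -> ad a (t * u) = t * ad a u.
Proof. by move=> /centerP tF; rewrite /ad mulrBr !mulrA (tF a). Qed.

Lemma iter_ad0 a k : iter k (ad a) 0 = 0.
Proof. by elim: k => //= k ->; rewrite ad0. Qed.

Lemma ad_eq0 a : (forall u, ad a u = 0) -> a \in F.
Proof.
move=> ada; apply/centerP => y; apply/eqP; rewrite -subr_eq0.
exact/eqP/ada.
Qed.

(** Since delta_a x = (ad a x) a^-1 and right multiplication by a commutes with ad a, the factor a^r
    absorbs the r inverses. *)
Lemma iter_delta a r u : a \is a GRing.unit ->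
  iter r (delta a) (u * a ^+ r) = iter r (ad a) u.
Proof.
move=> ua; have dE x : delta a x = ad a x * a^-1.
  by rewrite /delta /ad mulrBl mulrK.
have aV : GRing.comm a a^-1 by apply: commrV.
elim: r u => [|r IHr] u; first by rewrite mulr1.
rewrite iterSr dE exprS mulrA adMr; last exact: commrX.
have -> : ad a (u * a) * a ^+ r * a^-1 = ad a u * a ^+ r.
  by rewrite adMr// -!mulrA; congr (_ * _); rewrite mulrA -exprS exprSr mulrK.
by rewrite IHr iterSr.
Qed.

(** Binomial formula: left multiplication by a is the sum of ad a and right multiplication by a,
    which commute. The bound N is free so that expansions for different n can be added. *)
Lemma leibniz_ad a u n N : (n < N)%N ->
  a ^+ n * u = \sum_(k < N) iter k (ad a) u * a ^+ (n - k) *+ 'C(n, k).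
Proof.
elim: n N u => [|n IHn] [//|N] u.
  move=> _; by rewrite big_ord_recl /= !mul1r mulr1 big1 ?addr0.
rewrite ltnS => nN; rewrite exprSr -mulrA.
have -> : a * u = ad a u + u * a by rewrite /ad subrK.
rewrite mulrDr mulrA (IHn N)// (IHn N.+1 u)//; last exact: leqW.
rewrite mulr_suml !big_ord_recl /= !subn0 !bin0 !mulr1n -mulrA -exprSr addrCA.
congr (_ + _); rewrite -big_split; apply: eq_bigr => k _ /=.
rewrite -!/(iter _ _ _) -iterSr /= /bump add1n subSS binS mulrnDr addrC.
congr (_ + _); rewrite mulrnAl -mulrA -exprSr.
have [ltkn|] := ltnP k n; first by rewrite -subSn.
by move=> nk; rewrite bin_small.
Qed.

Definition separable a := exists f : {poly D},
  [/\ f \is a polyOver F, root f a & f^`().[a] != 0].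

Hypothesis divD : GRing.field_axiom D.

(** Expand f(a) u = 0 in iterates of ad a: the coefficients [h k] are the Hasse derivatives of f at
    a, with h_0 = f(a) = 0 and h_1 = f'(a) invertible, so one can solve for ad a u. *)
Lemma separable_ad_expand a : separable a ->
  exists (n : nat) (h : nat -> D), (forall k, GRing.comm a (h k)) /\
    forall u, ad a u = \sum_(k < n) iter k.+2 (ad a) u * h k.
Proof.
move=> [f [fF /rootP fa /divD uf']].
pose h k := \sum_(i < size f) f`_i * a ^+ (i - k) *+ 'C(i, k).
have ah k : GRing.comm a (h k).
  apply: commr_sum => i _; apply/commrMn/commrM; last exact/commrX.
  by apply/commr_sym => //; apply/centerP/(polyOverP fF).
have h0 : h 0%N = 0.
  rewrite -[RHS]fa horner_coef; apply: eq_bigr => i _.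
  by rewrite subn0 bin0.
have h1 : h 1%N = f^`().[a].
  rewrite horner_poly /h; case: (size f) => [|n]; first by rewrite !big_ord0.
  rewrite big_ord_recl bin0n mulr0n add0r; apply: eq_bigr => i _ /=.
  by rewrite /bump add1n bin1 subn1 mulrnAl.
have hE u : \sum_(k < (size f).+2) iter k (ad a) u * h k = 0.
  transitivity (f.[a] * u); last by rewrite fa mul0r.
  rewrite horner_coef mulr_suml /h.
  under eq_bigr do rewrite mulr_sumr.
  rewrite exchange_big; apply: eq_bigr => i _ /=.
  rewrite -mulrA (@leibniz_ad _ _ _ (size f).+2); last first.
    exact: leq_trans (ltn_ord i) (leqW (leqnSn _)).
  rewrite mulr_sumr; apply: eq_bigr => k _.
  have /centerP fi := polyOverP fF i.
  by rewrite !mulrnAr !mulrA fi.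
exists (size f), (fun k => - h k.+2 * f^`().[a]^-1); split=> [k|u].
  by rewrite -h1; apply: commrM; [apply/commrN/ah|apply/commrV/ah].
have := hE u; rewrite !big_ord_recl /= h0 mulr0 add0r h1 => /eqP.
rewrite addr_eq0 => /eqP /(congr1 ( *%R^~ f^`().[a]^-1)).
rewrite mulrK// => ->; rewrite mulNr mulr_suml -sumrN; apply: eq_bigr => k _.
by rewrite mulNr mulrN mulrA.
Qed.

Lemma separable_ad2 a u : separable a -> ad a (ad a u) = 0 -> ad a u = 0.
Proof.
move=> /separable_ad_expand[n [h [_ hE]]] adu; rewrite hE big1// => k _.
by rewrite !iterSr adu iter_ad0 mul0r.
Qed.

(** As the h_k commute with a, the expansion exhibits ad a u as ad a (ad a w) for some w; repeat
    with w. *)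
Lemma separable_ad_iter a r u : separable a ->
  exists u', ad a u = iter r.+1 (ad a) u'.
Proof.
move=> sa; have [n [h [ah hE]]] := separable_ad_expand sa.
elim: r u => [|r IHr] u; first by exists u.
have -> : ad a u = ad a (ad a (\sum_(k < n) iter k (ad a) u * h k)).
  rewrite hE !ad_sum; apply: eq_bigr => k _ /=.
  by rewrite !adMr.
by have [u' ->] := IHr (\sum_(k < n) iter k (ad a) u * h k); exists u'.
Qed.

End InnerDerivations.

(** * Commutators with a separable element have unbounded degree *)

Section AlgebraicCommutators.
Local Open Scope ring_scope.
Local Open Scope classical_set_scope.
Variable D : unitRingType.
Hypothesis divD : GRing.field_axiom D.
Local Notation F := (center D).
Implicit Types a b u v x y : D.

Lemma dep_last n (w : 'I_n.+1 -> D) :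
  indep (w \o widen_ord (leqnSn n)) -> ~ indep w ->
  span (w \o widen_ord (leqnSn n)) (w ord_max).
Proof.
move=> iw /existsNP[c /not_implyP[cF /not_implyP[ce]]].
move=> /existsNP[j cj].
pose c' i := c (widen_ord (leqnSn n) i).
rewrite big_ord_recr /= in ce.
have [cm|/divD um] := eqVneq (c ord_max) 0.
  case: cj; rewrite cm mul0r addr0 in ce.
  have c'0 := iw c' (fun i => cF _) ce.
  case: (unliftP ord_max j) => [k ->|->//].
  by rewrite -(c'0 k) /c'; congr c; apply/val_inj; exact: lift_max.
exists (fun i => - (c ord_max)^-1 * c' i); split=> [i|].
  by rewrite rpredM ?rpredN ?rpredV ?cF.
move/eqP: ce; rewrite addrC addr_eq0 => /eqP /(congr1 ( *%R (c ord_max)^-1)).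
rewrite mulKr// => ->; rewrite mulrN -mulNr mulr_sumr.
by apply: eq_bigr => i _; rewrite mulrA.
Qed.

Lemma noncomm_subrXX x y n :
  y ^+ n - x ^+ n = \sum_(j < n) y ^+ (n.-1 - j) * (y - x) * x ^+ j.
Proof.
elim: n => [|n IHn]; first by rewrite big_ord0 subrr.
rewrite big_ord_recr /= subnn mul1r.
have -> : \sum_(j < n) y ^+ (n - j) * (y - x) * x ^+ j = y * (y ^+ n - x ^+ n).
  rewrite IHn mulr_sumr; apply: eq_bigr => j _; rewrite !mulrA -exprS.
  by congr (_ ^+ _ * _ * _); case: n j {IHn} => [[]//|n] j; rewrite subSn// -ltnS.
by rewrite mulrBr mulrBl -!exprS addrA subrK.
Qed.

(** The relation reads P + a Q = 0 with P and Q in F[v]. Both commute with v, so (a v - v a) Q = 0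
    and Q = 0. *)
Lemma indep_powers_pair n v a (c1 c2 : 'I_n -> D) :
  indep (fun i : 'I_n => v ^+ i) -> a * v != v * a ->
  (forall i, c1 i \in F) -> (forall i, c2 i \in F) ->
  \sum_i c1 i * v ^+ i + \sum_i c2 i * (a * v ^+ i) = 0 ->
  (forall i, c1 i = 0) /\ (forall i, c2 i = 0).
Proof.
move=> iv av c1F c2F; set P := \sum_i c1 i * v ^+ i.
pose Q := \sum_i c2 i * v ^+ i.
have -> : \sum_i c2 i * (a * v ^+ i) = a * Q.
  rewrite mulr_sumr; apply: eq_bigr => i _.
  by rewrite !mulrA (centerP _ (c2F i)).
have vc (c : 'I_n -> D) : (forall i, c i \in F) -> GRing.comm v (\sum_i c i * v ^+ i).
  move=> cF; apply: commr_sum => i _; apply: commrM; last exact: commrX.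
  exact/commr_sym/centerP.
move=> PQ; suff Q0 : Q = 0.
  by split; apply: iv => //; move: PQ; rewrite Q0 mulr0 addr0.
have vQ : v * Q = Q * v := vc _ c2F; have vP : v * P = P * v := vc _ c1F.
have /eqP: (a * v - v * a) * Q = 0.
  move/eqP: PQ; rewrite addrC addr_eq0 => /eqP aQ.
  by rewrite mulrBl -!mulrA vQ aQ mulrA aQ mulNr mulrN vP subrr.
move=> /eqP /(div_mulf_eq0 divD)[] // /eqP.
by rewrite subr_eq0 (negPf av).
Qed.

Variable U : set_system D.
Hypothesis PU : ProperFilter U.
Hypothesis UF : U [set t | t \in F].
Hypothesis Une : forall c, U [set t | t <> c].
Hypothesis ncfD : ~ centrally_finite D.

(* The sum below is the coefficient of t in f(v + t x), where f is the minimal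
   polynomial of [v]. *)
Lemma derivative_max_degree m v x (c : 'I_m -> D) :
  (forall i, c i \in F) -> v ^+ m = \sum_i c i * v ^+ i ->
  indep (fun i : 'I_m => v ^+ i) ->
  (forall t, t \in F -> ~ indep (fun i : 'I_m.+1 => (v + t * x) ^+ i)) ->
  span (fun i : 'I_m => v ^+ i)
    (\sum_(j < m) (v ^+ (m.-1 - j) -
       \sum_(i < m) c i * (if (j < i)%N then v ^+ (i.-1 - j) else 0)) *
       x * v ^+ j).
Proof.
move=> cF vm iv dep.
pose y t := v + t * x.
pose w k j t : D := if (j < k)%N then y t ^+ (k.-1 - j) else 0.
pose G k t := \sum_(j < m) w k j t * x * v ^+ j.
have yX k t : t \in F -> (k <= m)%N -> y t ^+ k = v ^+ k + t * G k t.
  move=> /centerP tF km; apply/eqP; rewrite addrC -subr_eq noncomm_subrXX.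
  rewrite (big_ord_widen _ (fun j => y t ^+ (k.-1 - j) * (y t - v) * v ^+ j) km).
  rewrite big_mkcond mulr_sumr; apply/eqP; apply: eq_bigr => j _.
  rewrite /w; case: ifP; rewrite ?mul0r ?mulr0// => _.
  have -> : y t - v = t * x by rewrite /y addrAC subrr add0r.
  by rewrite !mulrA tF.
(* Here t g(t) = y(t)^m - sum_i c_i y(t)^i, so for t nonzero g(t) and the powers of y(t) below m are
   dependent; in the limit g(0) falls in the span of the powers of v. *)
pose g t := G m t - \sum_(i < m) c i * G i t.
have ry : regular U y.
  apply: regularD => //; first exact: regular_cst.
  by apply: regularM => //; [apply: regular_id|apply: regular_cst].
have rG k : regular U (G k).
  apply: regular_sum => // j; apply: regularM => //; last exact: regular_cst.
  apply: regularM => //; last exact: regular_cst.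
  rewrite /w; case: (j < k)%N; last exact: regular_cst.
  exact: regularX.
have rg : regular U g.
  apply: regularB => //; apply: regular_sum => // i; apply: regularM => //.
  exact: regular_cst.
pose f (i : 'I_m.+1) t := if (i < m)%N then y t ^+ i else g t.
have y0 : y 0 = v by rewrite /y mul0r addr0.
have fw t : (fun i => f i t) \o widen_ord (leqnSn m) = fun i : 'I_m => y t ^+ i.
  by apply/funext => i; rewrite /f /= ltn_ord.
have := @dep_last m (f ^~ 0).
rewrite fw y0 {2}/f /= ltnn => H.
have -> : \sum_(j < m) (v ^+ (m.-1 - j) -
       \sum_(i < m) c i * (if (j < i)%N then v ^+ (i.-1 - j) else 0)) *
       x * v ^+ j = g 0.
  rewrite /g /G; under [X in _ = _ - X]eq_bigr do rewrite mulr_sumr.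
  rewrite exchange_big -sumrB; apply: eq_bigr => j _ /=.
  rewrite /w ltn_ord y0 !mulrBl; congr (_ - _); rewrite !mulr_suml.
  by apply: eq_bigr => i _; rewrite !mulrA.
apply: H => //; apply: (limit_dep divD PU UF Une ncfD) => [i|].
  by rewrite /f; case: (i < m)%N => //; apply: regularX.
apply: filterS2 UF (Une 0) => t /= tF t0 ift; apply: (dep t tF) => d dF.
have fE : y t ^+ m = \sum_(i < m) c i * y t ^+ i + t * g t.
  rewrite yX// vm /g mulrBr addrCA addrC; congr (_ + _); apply/eqP.
  rewrite eq_sym subr_eq mulr_sumr -big_split; apply/eqP; apply: eq_bigr => i _.
  by rewrite yX ?mulrDr 1?ltnW//= !mulrA (centerP _ tF).
rewrite big_ord_recr /= fE => de.
pose wd := widen_ord (leqnSn m).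
pose d' (i : 'I_m.+1) := if unlift ord_max i is Some j
  then d (wd j) + d ord_max * c j else d ord_max * t.
have wdE j : wd j = lift ord_max j by apply/val_inj/esym/lift_max.
have d'0 : forall i, d' i = 0.
  apply: ift => [i|].
    rewrite /d'; case: unlift => [j|]; last by rewrite rpredM.
    by rewrite rpredD ?rpredM.
  rewrite big_ord_recr /= {2}/f /= ltnn {2}/d' unlift_none -[RHS]de.
  rewrite (mulrDr (d ord_max)) (mulrA (d ord_max) t) addrA; congr (_ + _).
  rewrite mulr_sumr -big_split; apply: eq_bigr => i _ /=.
  by rewrite /f /= ltn_ord -/wd wdE /d' liftK mulrDl mulrA wdE.
have dm : d ord_max = 0.
  have := d'0 ord_max; rewrite /d' unlift_none.
  by move=> /(div_mulf_eq0 divD)[].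
move=> i; case: (unliftP ord_max i) => [j ->|->//].
by have := d'0 (lift ord_max j); rewrite /d' liftK dm mul0r addr0 wdE.
Qed.

(** Induction on n yields v = [a, u0] of maximal degree n + 1. Then u |-> T([a, u]) has finite rank,
    hence is zero. If a and v do not commute, the v^i and a v^i are independent, and the coefficient
    -1 belonging to a v^n contradicts [indep_op]. If they commute, v = 0 by separability, so n = 0,
    T is the identity and ad a = 0. *)
Lemma commutators_not_algebraic a n : separable a -> a \notin F ->
  ~ (forall u, ~ indep (fun i : 'I_n.+1 => ad a u ^+ i)).
Proof.
move=> sa aF; elim: n => [|n IHn] alg.
  apply: (alg 0) => c cF; rewrite big_ord1 mulr1 => c0 i.
  by rewrite ord1.
have [u0 iu0] : exists u, indep (fun i : 'I_n.+1 => ad a u ^+ i).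
  by apply: contrapT => /forallNP.
set v := ad a u0 in iu0.
have wE : (fun i : 'I_n.+2 => v ^+ i) \o widen_ord (leqnSn n.+1)
    = fun i : 'I_n.+1 => v ^+ i by apply/funext.
have [c [cF vm]] : span (fun i : 'I_n.+1 => v ^+ i) (v ^+ n.+1).
  by have := @dep_last n.+1 (fun i => v ^+ i); rewrite wE; apply=> //; exact: (alg u0).
pose b (j : 'I_n.+1) := v ^+ (n - j) -
  \sum_(i < n.+1) c i * (if (j < i)%N then v ^+ (i.-1 - j) else 0).
pose T x := \sum_(j < n.+1) b j * x * v ^+ j.
have bn : b ord_max = 1.
  rewrite /b subnn big1 ?subr0// => i _.
  by rewrite ltnNge -ltnS ltn_ord mulr0.
have Ta u : span (fun i : 'I_n.+1 => v ^+ i) (T (ad a u)).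
  apply: derivative_max_degree => // t tF.
  by rewrite /v -adZ// -adD; apply: alg.
pose L (k : 'I_(n.+1 + n.+1)) :=
  match split k with inl j => - b j | inr j => b j * a end.
pose R (k : 'I_(n.+1 + n.+1)) :=
  match split k with inl j => a * v ^+ j | inr j => v ^+ j end.
have Es (j : 'I_n.+1) : split (lshift n.+1 j) = inl j by apply: (unsplitK (inl j)).
have Er (j : 'I_n.+1) : split (rshift n.+1 j) = inr j by apply: (unsplitK (inr j)).
have TE u : T (ad a u) = \sum_k L k * u * R k.
  rewrite big_split_ord /= /T /L /R -big_split; apply: eq_bigr => j _ /=.
  by rewrite Es Er /ad mulrBr mulrBl addrC !mulNr !mulrA.
have T0 u : T (ad a u) = 0.
  rewrite TE; apply: (finite_rank_op divD ncfD).
  by exists 'I_n.+1, (fun i : 'I_n.+1 => v ^+ i) => x; rewrite -TE.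
have [av|av] := eqVneq (a * v) (v * a).
  have v0 : v = 0.
    by apply: (separable_ad2 divD sa); rewrite /ad -/(ad a u0) -/v av subrr.
  have [n0|n_gt0] := posnP n; last first.
    pose i1 := inord 1 : 'I_n.+1.
    have i1E : i1 = 1%N :> nat by rewrite inordK.
    have E1 : \sum_(i < n.+1) (i == i1)%:R * v ^+ i = 0.
      rewrite (bigD1 i1)//= i1E v0 expr1 mulr0 big1 ?addr0// => i /negPf->.
      by rewrite mul0r.
    have /eqP := iu0 _ (fun i => rpred_nat _ _) E1 i1.
    by rewrite eqxx oner_eq0.
  case/negP: aF; apply: ad_eq0 => u; rewrite -[RHS](T0 u) /T.
  rewrite big_ord_recr big1 => [|i _]; last first.
    by case: i => i lti; exfalso; rewrite n0 in lti.
  by rewrite bn mul1r /= add0r n0 expr0 mulr1.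
have L0 : L (lshift n.+1 ord_max) = 0.
  apply: (@indep_op _ divD _ L R); last by move=> x; rewrite -TE.
  move=> d dF; rewrite big_split_ord /= /R addrC => dE.
  have [] := @indep_powers_pair n.+1 v a (d \o @rshift _ _) (d \o @lshift _ _) iu0 av.
  - by move=> i; apply: dF.
  - by move=> i; apply: dF.
  - rewrite -[RHS]dE; congr (_ + _); apply: eq_bigr => i _ /=.
      by rewrite Er.
    by rewrite Es.
  - move=> d1 d2 i; rewrite -(splitK i).
    by case: (split i) => j /=; [apply: d2|apply: d1].
by move: L0; rewrite /L Es bn => /eqP; rewrite oppr_eq0 oner_eq0.
Qed.
End AlgebraicCommutators.

(** * Almost subnormal chains and their tangents *)

Section Chains.
Local Open Scope ring_scope.
Local Open Scope classical_set_scope.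
Variable D : unitRingType.
Hypothesis divD : GRing.field_axiom D.
Local Notation F := (center D).
Implicit Types (S : D -> Prop) (a u h x y : D).

Definition unit_subgroup S :=
  [/\ S 1, forall x y, S x -> S y -> S (x * y), forall x, S x -> S x^-1
    & forall x, S x -> x != 0].

(* A finite colouring of [S] separating the left cosets of [S'] expresses that
   [S'] has finite index. *)
Definition chain_step S S' := (forall x, S' x -> S x) /\
  ((forall a y, S' a -> S y -> S' (y * a * y^-1)) \/
   exists (C : finType) (chi : D -> C),
     forall x y, S x -> S y -> chi x = chi y -> S' (x^-1 * y)).

(** Chains consist of predicates on [D], so that they restrict easily to division subrings. *)
Definition almost_subnormal_chain (S : nat -> D -> Prop) r :=
  [/\ forall i, unit_subgroup (S i), forall x, x != 0 -> S 0%N x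
    & forall i, (i < r)%N -> chain_step (S i) (S i.+1)].

Lemma chain_sub (S : nat -> D -> Prop) r i x :
  almost_subnormal_chain S r -> (i <= r)%N -> S r x -> S i x.
Proof.
move=> [_ _ step] ir Sr; rewrite -(subKn ir); move: (r - i)%N (leq_subr i r) => k.
elim: k => [|k IHk] kr; first by rewrite subn0.
have rk : (r - k.+1 < r)%N by rewrite ltn_subrL; case: r {step Sr ir IHk} kr.
have [sub _] := step _ rk; apply: sub.
by rewrite -subSn// subSS; apply/IHk/ltnW.
Qed.

Lemma unit_subgroupX S x n : unit_subgroup S -> S x -> S (x ^+ n).
Proof.
by move=> [S1 SM _ _] Sx; elim: n => // n IHn; rewrite exprS; apply: SM.
Qed.

Lemma step_commutator S S' a y : unit_subgroup S' ->
  (forall a y, S' a -> S y -> S' (y * a * y^-1)) -> S' a -> S y ->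
  S' (a * y * a^-1 * y^-1).
Proof.
move=> [_ SM SV _] conj Sa Sy; rewrite -!mulrA; apply: SM => //.
by rewrite !mulrA; apply: conj => //; apply: SV.
Qed.

Lemma pigeonhole_nat (C : finType) (g : nat -> C) :
  exists i j, [/\ (i < j)%N, (j <= #|C|)%N & g i = g j].
Proof.
pose h (i : 'I_(#|C|).+1) := g i.
have /injectivePn[i [j ij gij]] : ~~ injectiveb h.
  by apply/injectiveP => /leq_card; rewrite card_ord ltnn.
wlog ltij : i j ij gij / (i < j)%N => [wlog_lt|].
  have [/wlog_lt|/wlog_lt|] := ltngtP i j; [exact| |].
    by apply; rewrite 1?eq_sym.
  by move/val_inj => eij; rewrite eij eqxx in ij.
by exists i, j; split=> //; rewrite -ltnS ltn_ord.
Qed.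

(** Two of the powers y^0, ..., y^|C| share a colour, so S' contains some y^k with 1 <= k <= |C|,
    and k divides |C|!. *)
Lemma step_power S S' (C : finType) (chi : D -> C) :
  unit_subgroup S -> unit_subgroup S' ->
  (forall x y, S x -> S y -> chi x = chi y -> S' (x^-1 * y)) ->
  forall y, S y -> S' (y ^+ (#|C|)`!).
Proof.
move=> gS gS' col y Sy.
have uy : y \is a GRing.unit by apply: divD; case: gS => _ _ _; apply.
have [i [j [ij jC cij]]] := pigeonhole_nat (fun n => chi (y ^+ n)).
have Sji : S' (y ^+ (j - i)).
  have := col _ _ (unit_subgroupX i gS Sy) (unit_subgroupX j gS Sy) cij.
  by rewrite -{1}(subnKC (ltnW ij)) exprD mulKr ?unitrX.
have /dvdnP[q ->] : (j - i %| (#|C|)`!)%N.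
  by rewrite dvdn_fact// subn_gt0 ij (leq_trans (leq_subr _ _)).
by rewrite mulnC exprM; apply: unit_subgroupX.
Qed.

Section Tangents.
Variable U : set_system D.
Hypothesis UU : UltraFilter U.
Hypothesis UF : U [set t | t \in F].
Hypothesis Une : forall c, U [set t | t <> c].

Let PU : ProperFilter U. Proof. exact: ultra_proper. Qed.

Lemma ultra_colour (C : finType) (chi : D -> C) :
  exists c, U [set t | chi t = c].
Proof.
apply: contrapT => /forallNP nU.
have Un : U [set t | forall c, chi t <> c].
  apply: filter_forall => c.
  by have [/nU|] := in_ultra_setVsetC [set t | chi t = c] UU.
by have [t /(_ (chi t))] := filter_ex Un.
Qed.

Definition tangent S h := exists H : D -> D,
  [/\ regular U H, H 0 = h & U [set t | S (1 + t * H t)]].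

Lemma regular_curve (H : D -> D) :
  regular U H -> regular U (fun t => 1 + t * H t).
Proof.
move=> rH; apply: regularD => //; first exact: regular_cst.
by apply: regularM => //; apply: regular_id.
Qed.

Lemma curve0 (H : D -> D) : 1 + 0 * H 0 != 0 :> D.
Proof. by rewrite mul0r addr0 oner_neq0. Qed.

(** The commutator of a and 1 + t H is 1 + t delta_a(H) (1 + t H)^-1. Constraining only these
    commutators covers normal steps as well as S' = S containing a. *)
Lemma tangent_delta S S' a h : a != 0 ->
  (forall y, S y -> S' (a * y * a^-1 * y^-1)) ->
  tangent S h -> tangent S' (delta a h).
Proof.
move=> a0 com [H [rH H0 SH]]; have ua := divD a0.
have rW := regular_curve rH.
exists (fun t => delta a (H t) * (1 + t * H t)^-1); split.
- apply: regularM => //; last by apply: regularV => //; apply: curve0.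
  apply: regularB => //; apply: regularM => //; last exact: regular_cst.
  by apply: regularM => //; apply: regular_cst.
- by rewrite mul0r addr0 invr1 mulr1 H0.
- apply: filterS3 UF SH (regular_near divD PU UF Une rW (curve0 H)).
  move=> t /= /centerP tF SW /eqP /divD uW.
  have -> : 1 + t * (delta a (H t) * (1 + t * H t)^-1) =
            a * (1 + t * H t) * a^-1 * (1 + t * H t)^-1; last exact: com.
  rewrite mulrA -{1}(divrr uW) -mulrDl; congr (_ * _).
  rewrite /delta mulrBr [1 + _]addrC [LHS]addrC addrA subrK mulrDr mulr1 mulrDl.
  by rewrite divrr// !mulrA (tF a).
Qed.

(** The quotient (1 + t H)^-1 (1 + t H') equals 1 + t (1 + t H)^-1 (H' - H). *)
Lemma tangent_sub S S' (H H' : D -> D) : regular U H -> regular U H' ->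
  U [set t | S' ((1 + t * H t)^-1 * (1 + t * H' t))] ->
  tangent S' (H' 0 - H 0).
Proof.
move=> rH rH' SHH.
have rW := regular_curve rH.
exists (fun t => (1 + t * H t)^-1 * (H' t - H t)); split.
- apply: regularM => //; first by apply: regularV => //; apply: curve0.
  exact: regularB.
- by rewrite mul0r addr0 invr1 mul1r.
- apply: filterS3 UF SHH (regular_near divD PU UF Une rW (curve0 H)).
  move=> t /= /centerP tF SW /eqP /divD uW.
  rewrite mulrA tF -mulrA -{1}(mulVr uW) -mulrDr mulrBr.
  move: SW; congr (S' (_ * _)).
  by rewrite [1 + t * H t]addrC [RHS]addrC addrA subrK addrC.
Qed.

Lemma deltaB a u v : delta a (u - v) = delta a u - delta a v.
Proof. by rewrite /delta mulrBr mulrBl !opprD !opprK addrACA. Qed.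

Lemma deltaZ a t u : t \in F -> delta a (t * u) = t * delta a u.
Proof. by move=> /centerP tF; rewrite /delta mulrBr !mulrA (tF a). Qed.

Lemma iter_deltaZ a r t u :
  t \in F -> iter r (delta a) (t * u) = t * iter r (delta a) u.
Proof. by move=> tF; elim: r => //= r ->; rewrite deltaZ. Qed.

Lemma iter_deltaB a r u v :
  iter r (delta a) (u - v) = iter r (delta a) u - iter r (delta a) v.
Proof. by elim: r => //= r ->; rewrite deltaB. Qed.

(** A step of finite index may lose individual tangents but keeps differences: two curves lying
    generically in the same coset have their quotient in the smaller subgroup. So the induction
    carries a finite colouring of the directions u. *)
Lemma chain_tangent_colour (S : nat -> D -> Prop) r a i :
  almost_subnormal_chain S r -> S r a -> (i <= r)%N ->
  exists (C : finType) (chi : D -> C), forall u v, chi u = chi v ->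
    tangent (S i) (iter i (delta a) (u - v)).
Proof.
move=> cS Sa; have [gS S0 step] := cS.
have a0 : a != 0 by have [_ _ _] := gS r; apply.
elim: i => [_|i IHi lt_ir].
  exists unit, (fun=> tt) => u v _ /=; exists (fun=> u - v).
  split=> //; first exact: regular_cst.
  have rW := regular_curve (@regular_cst _ U PU UF (u - v)).
  apply: filterS (regular_near divD PU UF Une rW (curve0 (fun=> u - v))).
  by move=> t /= /eqP; apply: S0.
have [C [chi Hchi]] := IHi (ltnW lt_ir).
have Sia : S i.+1 a by apply: chain_sub cS _ Sa.
have [sub [conj|[C' [chi' Hchi']]]] := step i lt_ir.
  exists C, chi => u v /Hchi; apply: tangent_delta => // y Sy.
  exact: step_commutator conj Sia Sy.
(* [col h] is the generic coset colour of a chosen curve in [S i] with tangent h; its value at other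
   h is arbitrary. *)
have /choice[col Hcol] : forall h, exists c, tangent (S i) h ->
    exists H : D -> D, [/\ regular U H, H 0 = h, U [set t | S i (1 + t * H t)]
      & U [set t | chi' (1 + t * H t) = c]].
  move=> h; have [[H [rH H0 SH]]|nh] := pselect (tangent (S i) h).
    have [c Uc] := ultra_colour (fun t => chi' (1 + t * H t)).
    by exists c => _; exists H.
  by exists (chi' 0) => /nh.
(* Subtracting the representative of its colour turns each u into one tangent direction of [S i]. *)
pose rep c := xget 0 [set u | chi u = c].
have repE u : chi (rep (chi u)) = chi u.
  by apply: (@xgetPex _ 0 [set v | chi v = chi u]); exists u.
pose T := iter i (delta a).
exists (C * C')%type, (fun u => (chi u, col (T (u - rep (chi u))))).
move=> u v [cuv]; rewrite -cuv => coluv /=.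
have [H [rH H0 SH colH]] := Hcol _ (Hchi _ _ (esym (repE u))).
have [H' [rH' H'0 SH' colH']] := Hcol _ (Hchi v _ (etrans (esym cuv) (esym (repE u)))).
have -> : delta a (iter i (delta a) (u - v)) = delta a (H 0 - H' 0).
  rewrite H0 H'0 -iter_deltaB; congr (delta a (iter i (delta a) _)).
  by rewrite opprB addrA subrK.
(* H(0) - H'(0) is already a tangent of [S i.+1]; one more delta_a, with a in that subgroup, keeps
   the count at i + 1. *)
apply: (@tangent_delta (S i.+1)) => // [y Sy|].
  have [_ SM SV _] := gS i.+1.
  by apply: (SM) => //; [apply: (SM) => //; [exact: SM|exact: SV]|exact: SV].
apply: (@tangent_sub (S i)) => //.
have Ucol : U [set t | chi' (1 + t * H' t) = chi' (1 + t * H t)].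
  apply: filterS2 colH colH' => t /= -> ->; rewrite -/T.
  by rewrite coluv.
by apply: filterS3 SH SH' Ucol => t /= St St' /Hchi'; apply.
Qed.

(** Generic multiples of u share one colour; two of them, t1 u and t2 u, give t = t1 - t2, since
    delta_a is F-linear. *)
Lemma chain_tangent (S : nat -> D -> Prop) r a u :
  almost_subnormal_chain S r -> S r a ->
  exists t, [/\ t \in F, t != 0 & tangent (S r) (t * iter r (delta a) u)].
Proof.
move=> cS Sa; have [C [chi Hchi]] := chain_tangent_colour cS Sa (leqnn r).
have [c Uc] := ultra_colour (fun t => chi (t * u)).
have [t1 [/= t1F ct1]] := filter_ex (filterI UF Uc).
have [t2 [/= t2F [ct2 t12]]] := filter_ex (filterI UF (filterI Uc (Une t1))).
exists (t1 - t2); split; first exact: rpredB.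
  by rewrite subr_eq0 eq_sym; apply/eqP.
rewrite -iter_deltaZ ?rpredB// mulrBl; apply: Hchi.
by rewrite ct1 ct2.
Qed.

(** The change from the powers of x to those of 1 + t x is triangular with diagonal entries t^k. *)
Lemma indep_powers_affine n t x : t \in F -> t != 0 ->
  indep (fun i : 'I_n => x ^+ i) -> indep (fun i : 'I_n => (1 + t * x) ^+ i).
Proof.
move=> tF t0 ix c cF; have ut := divD t0; have /centerP tC := tF.
have tX i : (1 + t * x) ^+ i = \sum_(k < i.+1) t ^+ k * x ^+ k *+ 'C(i, k).
  rewrite exprDn_comm; last exact/commr_sym/commr1.
  by apply: eq_bigr => k _; rewrite expr1n mul1r exprMn_comm//; apply: tC.
have {}tX (i : 'I_n) : (1 + t * x) ^+ i = \sum_(k < n) t ^+ k * x ^+ k *+ 'C(i, k).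
  rewrite tX (big_ord_widen n (fun k => t ^+ k * x ^+ k *+ 'C(i, k)))//.
  rewrite big_mkcond; apply: eq_bigr => k _; case: ltnP => // ik.
  by rewrite bin_small.
under eq_bigr do rewrite tX mulr_sumr.
rewrite exchange_big /= => ce.
have c0 (k : 'I_n) : \sum_(i < n) c i * t ^+ k *+ 'C(i, k) = 0.
  apply: (ix (fun k : 'I_n => \sum_(i < n) c i * t ^+ k *+ 'C(i, k))) => [j|].
    by apply: rpred_sum => i _; rewrite rpredMn ?rpredM ?rpredX.
  rewrite -[RHS]ce; apply: eq_bigr => j _; rewrite mulr_suml.
  by apply: eq_bigr => i _; rewrite mulrnAl mulrnAr mulrA.
(* Solve from the top down: the coefficient of x^i involves only the c_k with k >= i. *)
move=> i; have [m] := ubnP (n - i).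
elim: m i => // m IHm i ltm.
have := c0 i; rewrite (bigD1 i)//= binn mulr1n big1 ?addr0.
  by move=> E; apply: (mulIr (unitrX i ut)); rewrite mul0r.
move=> j ji; have [ij|ij|/val_inj eij] := ltngtP i j; last by rewrite eij eqxx in ji.
  rewrite IHm ?mul0r ?mul0rn//.
  by rewrite -ltnS (leq_trans _ ltm)// ltnS ltn_sub2l.
by rewrite bin_small.
Qed.

(** For t nonzero the powers of H(t) are dependent because those of 1 + t H(t) are; [limit_dep]
    passes to t = 0. *)
Lemma tangent_algebraic S h d : ~ centrally_finite D ->
  (forall x, S x -> ~ indep (fun i : 'I_d.+1 => x ^+ i)) ->
  tangent S h -> ~ indep (fun i : 'I_d.+1 => h ^+ i).
Proof.
move=> ncf alg [H [rH <- SH]].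
apply: (@limit_dep _ divD U PU UF Une ncf _ (fun i t => H t ^+ i)) => [i|].
  exact: regularX.
apply: filterS3 UF (Une 0) SH => t /= tF /eqP t0 /alg nia ia.
by apply: nia; apply: indep_powers_affine.
Qed.

(** From (1 + t H)^n = 1 it follows that H sum_i (1 + t H)^i vanishes for generic t, while its value
    at 0 is n h. *)
Lemma tangent_torsion S h n : n%:R != 0 :> D ->
  (forall x, S x -> x ^+ n = 1) -> tangent S h -> h = 0.
Proof.
move=> n0 tor [H [rH <- SH]].
pose f t := H t * \sum_(i < n) (1 + t * H t) ^+ i.
have rf : regular U f.
  apply: regularM => //; apply: regular_sum => // i.
  exact/regularX/regular_curve.
have f0 : f 0 = H 0 * n%:R.
  rewrite /f mul0r addr0; under eq_bigr do rewrite expr1n.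
  by rewrite sumr_const card_ord.
suff /(div_mulf_eq0 divD)[//|/eqP] : H 0 * n%:R = 0 by rewrite (negPf n0).
rewrite -f0; apply/eqP; apply: contrapT => /negP f00.
have [t [/= ft [t0 St]]] :=
  filter_ex (filterI (regular_near divD PU UF Une rf f00) (filterI (Une 0) SH)).
have := subrX1 (1 + t * H t) n; rewrite tor// subrr addrAC subrr add0r -mulrA.
by move=> /esym /(div_mulf_eq0 divD)[].
Qed.

End Tangents.
End Chains.

(** * Inseparable elements *)

Section Inseparable.
Local Open Scope ring_scope.
Local Open Scope classical_set_scope.
Variable D : unitRingType.
Hypothesis divD : GRing.field_axiom D.
Local Notation F := (center D).

Lemma div_natr0_pchar n : (0 < n)%N -> n%:R = 0 :> D -> exists p, p \in [pchar D].
Proof.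
have [m] := ubnP n; elim: m n => // m IHm n ltm n_gt0 n0.
have [n1|n1] := leqP n 1.
  have n1' : n = 1%N by apply/eqP; rewrite eqn_leq n1.
  by move/eqP: n0; rewrite n1' oner_eq0.
have pp := pdiv_prime n1.
move: n0; rewrite -(divnK (pdiv_dvd n)) natrM.
move=> /(div_mulf_eq0 divD)[q0|p0]; last first.
  by exists (pdiv n); rewrite inE pp p0 eqxx.
apply: (IHm (n %/ pdiv n)%N) => //.
  by rewrite -ltnS (leq_trans _ ltm)// ltnS ltn_Pdiv// prime_gt1.
by rewrite divn_gt0 ?pdiv_gt0// dvdn_leq// pdiv_dvd.
Qed.

(** Inseparability makes x a root of f', where f is its minimal polynomial, so f' = 0 by minimality;
    hence f = g(X^p), and g, of degree n / p, kills x^p. *)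
Lemma inseparable_degree (x : D) n : algebraic_of_degree x n -> ~ separable x ->
  exists p, p \in [pchar D] /\
    forall n', algebraic_of_degree (x ^+ p) n' -> (n' < n)%N.
Proof.
move=> [f [fm fF fx fmin] sf] nsx.
have f0 : f != 0 by apply: monic_neq0.
have n_gt0 : (0 < n)%N.
  rewrite lt0n; apply/eqP => n0; move: fx.
  have := fm; rewrite monicE lead_coefE sf n0 /= => /eqP f1.
  rewrite (size1_polyC (eq_leq (etrans sf (congr1 S n0)))) f1.
  by rewrite rootC oner_eq0.
have f'0 : f^`() = 0.
  apply/eqP; apply: contrapT => /negP f'0.
  have rf' : root f^`() x.
    by apply/negPn/negP => nr; apply: nsx; exists f; split.
  have := fmin _ (polyOver_deriv fF) f'0 rf'.
  by rewrite leqNgt lt_size_deriv.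
have f'i i : f`_i *+ i = 0.
  by case: i => [|i]; rewrite ?mulr0n// -coef_deriv f'0 coef0.
have fn : f`_n = 1 by move: fm; rewrite monicE lead_coefE sf => /eqP.
have [|p pD] := div_natr0_pchar n_gt0; first by rewrite -(f'i n) fn.
have p_gt1 : (1 < p)%N by apply/prime_gt1/(pcharf_prime pD).
have p_gt0 := ltnW p_gt1.
exists p; split=> // n' [h [hm hF hx hmin] sh].
pose g := \poly_(j < (n %/ p).+1) f`_(j * p).
have fg : f = g \Po 'X^p.
  apply/polyP => i; rewrite coef_comp_poly_Xn// coef_poly.
  case: ifP => [pi|/negbT pi].
    case: ltnP => [_|]; first by rewrite divnK.
    by move=> ltni; rewrite nth_default// sf; apply: contraTT ltni;
      rewrite -!leqNgt; apply: leq_div2r.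
  have : i%:R != 0 :> D by rewrite -(dvdn_pcharf pD).
  move=> i0; have := f'i i; rewrite -mulr_natr => /(div_mulf_eq0 divD)[]// /eqP.
  by rewrite (negPf i0).
have gF : g \is a polyOver F by apply: polyOver_poly => i _; apply: (polyOverP fF).
have g0 : g != 0 by apply: contraNneq f0 => g0; rewrite fg g0 comp_poly0.
have gx : root g (x ^+ p).
  apply/rootP; move/rootP: fx; rewrite fg comp_polyE horner_sum horner_coef.
  apply: etrans; apply: eq_bigr => i _.
  by rewrite hornerZ -!exprM hornerXn.
have := hmin g gF g0 gx; rewrite sh => /leq_trans/(_ (size_poly _ _)).
by rewrite ltnS => /leq_ltn_trans; apply; rewrite ltn_Pdiv.
Qed.

Lemma inseparable_power (N : D -> Prop) d p :
  unit_subgroup N -> p \in [pchar D] ->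
  (forall x, N x -> exists2 n, (n <= d)%N & algebraic_of_degree x n) ->
  (forall x, N x -> separable x -> x \in F) ->
  forall x, N x -> x ^+ (p ^ d) \in F.
Proof.
move=> gN pD alg sepF x Nx; have [n nd] := alg x Nx.
rewrite -(subnKC nd) expnD exprM; move: (d - n)%N => k xn; apply: rpredX.
elim/ltn_ind: n {nd k} x Nx xn => n IHn x Nx xn.
have [xF|xF] := boolP (x \in F); first exact: rpredX.
have [|p' [p'D degp]] := inseparable_degree xn.
  by move=> /(sepF x Nx); apply/negP.
have pp' : p' = p by move: p'D; rewrite (pcharf_eq pD) inE => /eqP.
rewrite {p' p'D}pp' in degp.
have Nxp := unit_subgroupX p gN Nx.
have [n' _ xpn'] := alg _ Nxp; have ltn'n := degp _ xpn'.
have := IHn _ ltn'n _ Nxp xpn'; rewrite -exprM -expnS.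
by rewrite -(subnKC ltn'n) expnD exprM => /rpredX.
Qed.

(** The p-th iterate of ad a is ad (a^p) = 0. If c = ad a v is nonzero and commutes with a, then u =
    c^-1 v a satisfies a u - u a = a. *)
Lemma radical_translation (a : D) p :
  p \in [pchar D] -> a \notin F -> a ^+ p \in F ->
  exists u, a * u = (u + 1) * a.
Proof.
move=> pD aF apF; have p_gt0 := prime_gt0 (pcharf_prime pD).
have adp u : iter p (ad a) u = 0.
  have := @leibniz_ad _ a u p p.+1 (ltnSn p).
  rewrite big_ord_recr (bigD1 (Ordinal p_gt0))//= subnn binn subn0 bin0 mulr1 !mulr1n.
  rewrite big1 ?addr0 => [/eqP|k k0]; last first.
    have : (p %| 'C(p, k))%N.
      by rewrite prime_dvd_bin ?(pcharf_prime pD)// ltn_ord andbT lt0n.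
    by case/dvdnP=> m ->; rewrite mulnC mulrnA (mulrn_pchar pD) mul0rn.
  by rewrite (centerP _ apF) addrC -subr_eq subrr => /eqP.
have [u1 au1] : exists u, ad a u <> 0.
  by apply/existsNP => ada; move/negP: aF; apply; apply: ad_eq0.
have ex : exists k, iter k (ad a) u1 == 0 by exists p; rewrite adp.
case: (ex_minnP ex) => -[|[|k]] /eqP.
- by move=> u10 _; case: au1; rewrite [u1]u10 ad0.
- by move=> /au1.
(* The least number of applications of ad a killing u1 is k + 2, so ad a v is the last nonzero
   iterate. *)
move=> ck0 kmin; set v := iter k (ad a) u1.
have c0 : ad a v != 0.
  by apply/negP => /(kmin k.+1); rewrite ltnn.
have uc := divD c0.
have ac : a * ad a v = ad a v * a by apply/eqP; rewrite -subr_eq0; apply/eqP.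
have acV : a * (ad a v)^-1 = (ad a v)^-1 * a := commrV ac.
exists ((ad a v)^-1 * v * a).
apply/eqP; rewrite mulrDl mul1r addrC -subr_eq; apply/eqP.
by rewrite !mulrA acV -!mulrA -mulrBr (mulrA a v) (mulrA v a) -mulrBl mulKr.
Qed.

End Inseparable.

(** * Conjugation by a radical element on a bicommutant *)

Section RadicalChain.
Local Open Scope ring_scope.
Local Open Scope classical_set_scope.
Variable D : unitRingType.
Hypothesis divD : GRing.field_axiom D.
Local Notation F := (center D).
Variable U : set_system D.
Hypothesis PU : ProperFilter U.
Hypothesis UF : U [set t | t \in F].
Hypothesis Une : forall c, U [set t | t <> c].
Variables (a u : D) (p : nat).
Hypothesis a0 : a != 0.
Hypothesis p_gt0 : (0 < p)%N.
Hypothesis apF : a ^+ p \in F.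
Hypothesis au : a * u = (u + 1) * a.

Let ua : a \is a GRing.unit. Proof. exact: divD. Qed.

(** The bicommutant of u is commutative, and [sigma] preserves it because it sends u to u + 1. On it
    [tau], the commutator with a, respects powers. *)
Let bicomm x := forall c, GRing.comm c u -> GRing.comm c x.
Let sigma x := a * x * a^-1.
Let tau x := sigma x * x^-1.

Let sigmaM x y : sigma (x * y) = sigma x * sigma y.
Proof. by rewrite /sigma !mulrA mulrVK. Qed.

Let sigmaX x n : sigma (x ^+ n) = sigma x ^+ n.
Proof.
by elim: n => [|n IHn]; rewrite ?exprS ?sigmaM ?IHn// /sigma mulr1 divrr.
Qed.

Let sigma_neq0 x : x != 0 -> sigma x != 0.
Proof.
move=> x0; apply/eqP => /(div_mulf_eq0 divD)[/(div_mulf_eq0 divD)[]|] /eqP.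
- exact/negP.
- exact/negP.
- by rewrite invr_eq0; apply/negP.
Qed.

Let bicomm_comm x y : bicomm x -> bicomm y -> GRing.comm x y.
Proof. by move=> bx b_y; apply: b_y; apply/commr_sym/bx. Qed.

Let bicomm_sigma x : bicomm x -> bicomm (sigma x).
Proof.
move=> bx c cu.
have aVu : a^-1 * (u + 1) = u * a^-1.
  by apply: (mulIr ua); rewrite mulrVK// -mulrA -au mulKr.
have cu1 : c * (u + 1) = (u + 1) * c.
  by rewrite mulrDr mulrDl mulr1 mul1r cu.
have /bx cx : GRing.comm (a^-1 * c * a) u.
  by rewrite /GRing.comm -mulrA au mulrA -(mulrA a^-1 c) cu1 mulrA aVu !mulrA.
have := congr1 (fun y => a * y * a^-1) cx.
by rewrite /GRing.comm /sigma !mulrA divrr// mul1r mulrK.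
Qed.

Let bicommM x y : bicomm x -> bicomm y -> bicomm (x * y).
Proof. by move=> bx b_y c cu; apply: commrM; [apply: bx|apply: b_y]. Qed.

Let bicommV x : bicomm x -> bicomm x^-1.
Proof. by move=> bx c cu; apply/commrV/bx. Qed.

Let bicomm_tau x : bicomm x -> bicomm (tau x).
Proof. by move=> bx; apply: bicommM; [apply: bicomm_sigma|apply: bicommV]. Qed.

Let tau_neq0 x : x != 0 -> tau x != 0.
Proof.
move=> x0; apply/eqP => /(div_mulf_eq0 divD)[] /eqP.
  exact/negP/sigma_neq0.
by rewrite invr_eq0; apply/negP.
Qed.

Let tauX x n : bicomm x -> tau (x ^+ n) = tau x ^+ n.
Proof.
move=> bx; rewrite /tau sigmaX exprMn_comm ?exprVn//.
exact/commrV/bicomm_comm/bx/bicomm_sigma.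
Qed.

Let tau_iter s x : bicomm x /\ x != 0 -> bicomm (iter s tau x) /\ iter s tau x != 0.
Proof.
move=> bx; elim: s => //= s [IH1 IH2]; split; first exact: bicomm_tau.
exact: tau_neq0.
Qed.

Let u_notin : u \notin F.
Proof.
apply/negP => /centerP uF; move/eqP: au; rewrite mulrDl mul1r uF addrC -subr_eq.
by rewrite subrr eq_sym (negPf a0).
Qed.

(* If tau (tau z) has exponent M then z' = tau z satisfies sigma (z'^M) = z'^M;
   since sigma^p = 1, iterating sigma (z^M) = z'^M z^M gives z'^(M p) = 1. *)
Let tau_not_torsion s M : (0 < M)%N ->
  ~ (forall y, bicomm y -> y != 0 -> iter s.+1 tau y ^+ M = 1).
Proof.
elim: s M => [|s IHs] M M0 tor.
  (* Applying the hypothesis to t + u gives (t + u + 1)^M = (t + u)^M for t in F, so P vanishes on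
     F; but P is nonzero, as P(-u) = 1. *)
  pose P := ('X + (u + 1)%:P) ^+ M - ('X + u%:P) ^+ M.
  have PE t : GRing.comm t u -> P.[t] = (t + (u + 1)) ^+ M - (t + u) ^+ M.
    move=> tu; have cp c : GRing.comm t c -> comm_poly ('X + c%:P) t.
      by move=> tc; rewrite /comm_poly !hornerE mulrDr mulrDl tc.
    have tu1 : GRing.comm t (u + 1) by apply: commrD => //; apply: commr1.
    by rewrite hornerD hornerN !horner_exp_comm ?hornerE//; apply: cp.
  have [P0|P0] := eqVneq P 0.
    have := PE (- u); rewrite P0 horner0 addrA addNr add0r expr1n expr0n.
    rewrite eqn0Ngt M0 subr0 => /(_ _)/eqP.
    by rewrite eq_sym oner_eq0 => /(_ (commr_sym (commrN (commr_refl u)))).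
  have [t [/= tF Pt]] := filter_ex (filterI UF (near_nonroot divD PU UF Une P0)).
  apply: Pt; have /centerP tC := tF; rewrite PE; last exact: tC.
  have tu0 : t + u != 0.
    apply: contraNneq u_notin => /eqP; rewrite addrC addr_eq0 => /eqP->.
    by rewrite rpredN.
  have btu : bicomm (t + u).
    by move=> c cu; apply: commrD => //; apply/commr_sym/tC.
  have := tor _ btu tu0; rewrite /= -tauX// /tau sigmaX => E.
  have <- : sigma (t + u) = t + (u + 1).
    by rewrite /sigma mulrDr -tC au -mulrDl mulrK.
  apply/eqP; rewrite subr_eq0; apply/eqP.
  have uM : (t + u) ^+ M \is a GRing.unit by rewrite unitrX// divD.
  by rewrite -[LHS](mulrVK uM) E mul1r.
apply: (IHs (M * p)%N); first by rewrite muln_gt0 M0.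
move=> y b_y y0; have [bz z0] := tau_iter s (conj b_y y0).
have [bz' z'0] := tau_iter s.+1 (conj b_y y0).
set z := iter s tau y in bz z0 bz' z'0 *; rewrite -/(iter _ _ _) /= -/z.
pose Y := z ^+ M; pose Z := tau z ^+ M.
have uY : Y \is a GRing.unit by rewrite unitrX// divD.
have uZ : Z \is a GRing.unit by rewrite unitrX// divD.
have sZ : sigma Z = Z.
  have := tor y b_y y0; rewrite /= -/z -tauX// /tau -/(tau z) -/Z => E.
  by rewrite -[LHS](mulrVK uZ) E mul1r.
have sY : sigma Y = Z * Y.
  by rewrite /Z -tauX// /tau mulrVK.
have sYn n : iter n sigma Y = Z ^+ n * Y.
  elim: n => [|n IHn]; first by rewrite mul1r.
  by rewrite /= IHn sigmaM sigmaX sZ sY mulrA -exprSr.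
have sn n x : iter n sigma x = a ^+ n * x * a ^- n.
  elim: n => [|n IHn] /=; first by rewrite mul1r invr1 mulr1.
  rewrite IHn /sigma !mulrA -exprS -!mulrA; congr (_ * (_ * _)).
  by rewrite -exprVn -exprSr exprVn.
have : Z ^+ p * Y = Y.
  rewrite -sYn sn (centerP _ apF) mulrK// unitrX//.
move=> /(congr1 ( *%R^~ Y^-1)); rewrite mulrK// divrr// => <-.
by rewrite exprM.
Qed.

(** Down the chain, a normal step costs one more [tau] and a step of finite index multiplies the
    exponent by a factorial. At the end [tau] of a central power is 1, against [tau_not_torsion]. *)
Lemma radical_chain_false (S : nat -> D -> Prop) r q :
  almost_subnormal_chain S r -> S r a -> (0 < q)%N ->
  ~ (forall x, S r x -> x ^+ q \in F).
Proof.
move=> cS Sa q0 SF; have [gS S0 step] := cS.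
have claim i : (i <= r)%N -> exists M s, (0 < M)%N /\
    forall y, bicomm y -> y != 0 -> S i (iter s tau y ^+ M).
  elim: i => [_|i IHi lt_ir].
    by exists 1%N, 0%N; split=> // y _ y0; apply: S0.
  have [M [s [M0 SM]]] := IHi (ltnW lt_ir).
  have Sia : S i.+1 a by apply: chain_sub cS _ Sa.
  have [_ [cj|[C [chi Hchi]]]] := step i lt_ir.
    exists M, s.+1; split=> // y b_y y0.
    have [bz z0] := tau_iter s (conj b_y y0).
    have := step_commutator (gS i.+1) cj Sia (SM y b_y y0).
    by rewrite -tauX.
  exists (M * (#|C|)`!)%N, s; split; first by rewrite muln_gt0 M0 fact_gt0.
  move=> y b_y y0; rewrite exprM.
  exact: (step_power divD (gS i) (gS i.+1) Hchi (SM y b_y y0)).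
have [M [s [M0 SM]]] := claim r (leqnn r).
apply: (@tau_not_torsion s (M * q)%N); first by rewrite muln_gt0 M0.
move=> y b_y y0; have [bz z0] := tau_iter s (conj b_y y0).
have /centerP cz := SF _ (SM y b_y y0).
rewrite /= -tauX// /tau exprM /sigma -cz mulrK// divrr//.
by rewrite !unitrX// divD.
Qed.

End RadicalChain.

(** * Division subrings and Wedderburn's theorem *)

Section DivisionSubring.
Local Open Scope ring_scope.
Variables (D : unitRingType) (K : {pred D}) (KD : divring_closed K).

Definition divring_pred of divring_closed K : {pred D} := K.
HB.instance Definition _ := GRing.isDivringClosed.Build D (divring_pred KD) KD.

Definition division_subring := {x : D | x \in divring_pred KD}.
HB.instance Definition _ := SubChoice.on division_subring.
HB.instance Definition _ := [SubChoice_isSubUnitRing of division_subring by <:].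

Hypothesis divD : GRing.field_axiom D.

Lemma division_subring_field : GRing.field_axiom division_subring.
Proof.
move=> x x0; rewrite unitrE -(inj_eq val_inj) /=.
by rewrite divrr//; apply: divD; apply: contraNneq x0 => x0; apply/eqP/val_inj.
Qed.

Lemma val_division_subringX (x : division_subring) n :
  val (x ^+ n) = val x ^+ n.
Proof. by elim: n => // n IHn; rewrite !exprS -IHn. Qed.

Lemma val_division_subring_nat n : val (n%:R : division_subring) = n%:R.
Proof. by elim: n => // n IHn; rewrite !mulrS -IHn. Qed.

Variables (s : seq D) (sK : forall x, x \in K -> x \in s).

Let code (x : division_subring) : seq_sub s := SeqSub (sK (valP x)).
Let decode (y : seq_sub s) : option division_subring := insub (val y).

Let codeK : pcancel code decode.
Proof. by move=> x; rewrite /decode valK. Qed.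

Definition finite_division_subring of pcancel code decode := division_subring.
HB.instance Definition _ := GRing.UnitRing.on (finite_division_subring codeK).
HB.instance Definition _ := Choice_isCountable.Build
  (finite_division_subring codeK)
  (@pcan_pickleK (seq_sub s) (finite_division_subring codeK) code decode codeK).
HB.instance Definition _ := isFinite.Build
  (finite_division_subring codeK)
  (@pcan_enumP (finite_division_subring codeK) (seq_sub s) code decode codeK).

Lemma wedderburn x y : x \in K -> y \in K -> x * y = y * x.
Proof.
move=> xK yK.
have dom : GRing.integral_domain_axiom (finite_division_subring codeK).
  move=> u v /(congr1 val) /= /(div_mulf_eq0 divD)[] E.
    by apply/orP; left; apply/eqP/val_inj.
  by apply/orP; right; apply/eqP/val_inj.
have /(congr1 val) := @finDomain_mulrC (finite_division_subring codeK) dom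
  (Sub x xK) (Sub y yK).
by [].
Qed.

End DivisionSubring.

(** * Torsion chains over an infinite centre *)

Section InfiniteCenter.
Local Open Scope ring_scope.
Local Open Scope classical_set_scope.
Variable D : unitRingType.
Hypothesis divD : GRing.field_axiom D.
Local Notation F := (center D).
Hypothesis Finf : ~ finite_set [set t | t \in F].

(** Take an ultrafilter refining the filter of sets that contain all but finitely many elements of
    F. *)
Lemma generic_ultrafilter : exists U : set_system D,
  [/\ UltraFilter U, U [set t | t \in F] & forall c, U [set t | t <> c]].
Proof.
pose G := [set A : set D | finite_set ([set t | t \in F] `\` A)].
have GF : ProperFilter G.
  split; first by rewrite /G /= setD0.
  split.
  - by rewrite /G /= setDT; apply: finite_set0.
  - by move=> A B; rewrite /G /= setDIr finite_setU.
  - by move=> A B AB; apply: sub_finite_set => t [tF tB]; split=> // /AB.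
have [U [UU GU]] := ultraFilterLemma GF.
exists U; split=> // [|c]; apply: GU; rewrite /G /=.
  by rewrite setDv; apply: finite_set0.
apply: (sub_finite_set _ (finite_set1 c)) => t [_ /= /contrapT tc].
exact: tc.
Qed.

(** The polynomial X^n - 1 makes a separable. Tangents of a torsion group vanish, so the r-th
    iterate of ad a is zero, and then so is ad a by [separable_ad_iter]. *)
Lemma torsion_chain_central (S : nat -> D -> Prop) r n a :
  almost_subnormal_chain S r -> n%:R != 0 :> D ->
  (forall x, S r x -> x ^+ n = 1) -> S r a -> a \in F.
Proof.
move=> cS n0 tor Sa; have [U [UU UF Une]] := generic_ultrafilter.
have a0 : a != 0 by have [gS _ _] := cS; have [_ _ _] := gS r; apply.
have sa : separable a.
  exists ('X^n - 1); split.
  - by rewrite rpredB ?rpred1// rpredX// polyOverX.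
  - by rewrite rootE hornerD hornerN hornerXn hornerC tor// subrr.
  - rewrite derivB derivXn -[1]/(1%:P) derivC subr0 hornerMn hornerXn.
    rewrite -mulr_natr; apply/eqP => /(div_mulf_eq0 divD)[/eqP|/eqP].
      apply/negP; have := unitrX n.-1 (divD a0).
      by apply: contraTneq => ->; rewrite unitr0.
    exact/negP.
have ad_r u : iter r (ad a) u = 0.
  rewrite -iter_delta; last exact: divD.
  have [t [tF t0]] := chain_tangent divD UU UF Une (u * a ^+ r) cS Sa.
  move=> /(tangent_torsion divD UU UF Une n0 tor) /(div_mulf_eq0 divD)[|//].
  by move/eqP; rewrite (negPf t0).
apply: ad_eq0 => u; have [u' ->] := separable_ad_iter divD r u sa.
by rewrite iterS ad_r ad0.
Qed.

End InfiniteCenter.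

(** * Finite centre: twisted eigenvectors and a finite exponent *)

Section FiniteCenter.
Local Open Scope ring_scope.
Local Open Scope classical_set_scope.
Variable D : unitRingType.
Hypothesis divD : GRing.field_axiom D.
Local Notation F := (center D).

(* Left multiplication by [a] annihilates X^m - 1 = prod_i (X - a^i), where the
   right coefficients act by right multiplication; so applying the factors
   v |-> a v - v a^i in turn to a nonzero [a, u] must reach 0. *)
Lemma twisted_eigenvector (a : D) m : (0 < m)%N -> a ^+ m = 1 ->
  (forall k, (0 < k < m)%N -> a ^+ k != 1) -> a \notin F ->
  exists j w, [/\ w != 0, a * w = w * a ^+ j & a ^+ j != a].
Proof.
move=> m0 am amin aF.
have a0 : a \is a GRing.unit.
  apply/divD/eqP => a0; move/eqP: am.
  by rewrite a0 expr0n gtn_eqF// eq_sym oner_eq0.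
pose rs := [seq a ^+ i | i <- iota 1 m].
pose phi u N (P : {poly D}) := \sum_(k < N) a ^+ k * u * P`_k.
have phiE u s : phi u (size s).+1 (\prod_(c <- s) ('X - c%:P)) =
    foldl (fun v c => a * v - v * c) u s.
  elim/last_ind: s => [|s c IHs].
    by rewrite big_nil /phi big_ord1 coefC mul1r mulr1.
  rewrite foldl_rcons -IHs -cats1 big_cat big_seq1 /= size_cat addn1.
  set P := \prod_(c <- s) _; rewrite mulrBr.
  have sP : (size P <= (size s).+1)%N by rewrite size_prod_XsubC.
  have -> : phi u (size s).+2 (P * 'X - P * c%:P) =
      phi u (size s).+2 (P * 'X) - phi u (size s).+2 (P * c%:P).
    by rewrite /phi -sumrB; apply: eq_bigr => k _; rewrite coefB mulrBr.
  congr (_ - _).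
    rewrite /phi big_ord_recl coefMX mulr0 add0r mulr_sumr.
    by apply: eq_bigr => k _; rewrite coefMX /= exprS !mulrA.
  rewrite /phi big_ord_recr /= coefMC nth_default// mul0r mulr0 addr0 mulr_suml.
  by apply: eq_bigr => k _; rewrite coefMC !mulrA.
have rsE : 'X^m - 1 = \prod_(c <- rs) ('X - c%:P).
  rewrite [LHS](@all_roots_prod_XsubC _ _ rs).
  - by rewrite lead_coefXnsubC// scale1r.
  - by rewrite size_XnsubC// size_map size_iota.
  - apply/allP => _ /mapP[i _ ->].
    rewrite rootE hornerD hornerN hornerXn hornerC.
    by rewrite -exprM mulnC exprM am expr1n subrr.
  - have: all (fun i => 0 < i <= m)%N (iota 1 m).
      by apply/allP => i; rewrite mem_iota add1n ltnS.
    have := iota_ltn_sorted 1 m; rewrite /rs; elim: (iota 1 m) => //= i s IHs.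
    rewrite path_sortedE; last exact: ltn_trans.
    move=> /andP[/allP is_ ss] /andP[/andP[i0 im] sm]; rewrite IHs// andbT.
    apply/allP => _ /mapP[j js ->]; apply/andP; split.
      by rewrite -!exprD addnC.
    have ij : (i < j)%N := is_ _ js; have /andP[j0 jm] := allP sm _ js.
    rewrite -(subnKC (ltnW ij)) exprD -[X in _ - X]mulr1 -mulrBr.
    rewrite unitrMl ?unitrX//; apply: divD; rewrite subr_eq0; apply: amin.
    by rewrite subn_gt0 ij (leq_trans _ jm)// ltn_subrL i0 j0.
have [u au0] : exists u, ad a u <> 0.
  by apply/existsNP => ada; move/negP: aF; apply; apply: ad_eq0.
have fold0 : foldl (fun v c => a * v - v * c) u rs = 0.
  rewrite -phiE -rsE /rs size_map size_iota /phi big_ord_recr /=.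
  rewrite (bigD1 (Ordinal m0))//= big1 ?addr0 => [|i].
    rewrite !coefB !coefXn !coefC am !mul1r eqxx (gtn_eqF m0) (ltn_eqF m0) /=.
    by rewrite sub0r subr0 mulrN mulr1 addNr.
  rewrite -val_eqE /= => /negPf i0.
  by rewrite coefB coefXn coefC (ltn_eqF (ltn_ord i)) i0 subrr mulr0.
(* The first factor is ad a itself, so the remaining exponents 2, ..., m all give powers different
   from a. *)
have rsS : rs = a :: [seq a ^+ i | i <- iota 2 m.-1].
  by rewrite /rs -{1}(prednK m0).
rewrite rsS /= -/(ad a u) in fold0.
have : exists w c, [/\ w != 0, c \in [seq a ^+ i | i <- iota 2 m.-1]
    & a * w - w * c = 0].
  move: (ad a u) au0 fold0; elim: [seq _ | _ <- _] => //= c s IHs v v0 vs.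
  have [vc|/eqP vc] := eqVneq (a * v - v * c) 0.
    by exists v, c; rewrite inE eqxx vc; split=> //; apply/eqP.
  have [w [c' [w0 c's wc']]] := IHs _ vc vs.
  by exists w, c'; rewrite inE c's orbT.
move=> [w [_ [w0 /mapP[i im ->] wc]]]; exists i, w; split=> //.
  by apply/eqP; rewrite -subr_eq0; apply/eqP.
move: im; rewrite mem_iota => /andP[i2 im].
rewrite -(subnKC (ltnW i2)) exprS -[X in _ != X]mulr1 (inj_eq (mulrI a0)).
apply: amin; rewrite subn_gt0 i2 /=.
move: im; rewrite add2n prednK// => im.
by rewrite -ltnS -subSn ?subn1// ltnW.
Qed.

Lemma frobenius_root1 p k (y : D) : p \in [pchar D] -> y ^+ (p ^ k) = 1 -> y = 1.
Proof.
move=> pD; elim: k y => [|k IHk] y; first by rewrite expr1.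
rewrite expnSr exprM => yp; apply: IHk.
move: (y ^+ (p ^ k)) yp => z zp.
have : (z - 1) ^+ p = 0.
  have := pFrobenius_autB_comm pD (commr1 z).
  by rewrite !pFrobenius_autE zp expr1n subrr.
have p0 : (0 < p)%N by apply/prime_gt0/(pcharf_prime pD).
move=> zp0; apply/eqP; rewrite -subr_eq0; apply/negPn/negP => /divD uz.
by have := unitrX p uz; rewrite zp0 unitr0.
Qed.

Hypothesis Ffin : finite_set [set t | t \in F].

Lemma finite_center_pchar : exists p, p \in [pchar D].
Proof.
have [fs Fs] := (@finite_seqP _ _).1 Ffin.
have nF n : (n%:R : D) \in fs.
  have : [set t | t \in F] (n%:R : D) by rewrite /= rpred_nat.
  by rewrite Fs.
pose g n : seq_sub fs := SeqSub (nF n).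
have [i [j [ij _ /(congr1 val) /= gij]]] := pigeonhole_nat g.
apply: (@div_natr0_pchar _ divD (j - i)); first by rewrite subn_gt0.
by rewrite natrB ?(ltnW ij)// gij subrr.
Qed.

Lemma finite_center_span (I : finType) (e : I -> D) :
  exists s : seq D, forall x, span e x -> x \in s.
Proof.
have [fs Fs] := (@finite_seqP _ _).1 Ffin.
exists [seq \sum_i val (c i) * e i | c : {ffun I -> seq_sub fs}] => x [c [cF ->]].
have cfs i : c i \in fs.
  by have : [set t | t \in F] (c i) := cF i; rewrite Fs.
apply/mapP; exists [ffun i => SeqSub (cfs i)]; first by rewrite mem_enum.
by apply: eq_bigr => i _; rewrite ffunE.
Qed.

Lemma algebraic_span d (x : D) n k : (n <= d)%N -> algebraic_of_degree x n ->
  span (fun i : 'I_d => x ^+ i) (x ^+ k).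
Proof.
move=> nd [f [fm fF /rootP fx _] sf].
have xn : x ^+ n = \sum_(i < n) - f`_i * x ^+ i.
  move: fx; rewrite horner_coef sf big_ord_recr /=.
  have -> : f`_n = 1 by move: fm; rewrite monicE lead_coefE sf => /eqP.
  rewrite mul1r addrC => /eqP; rewrite addr_eq0 -sumrN => /eqP->.
  by apply: eq_bigr => i _; rewrite mulNr.
have xd : span (fun i : 'I_d => x ^+ i) (x ^+ d).
  rewrite -(subnKC nd) exprD xn mulr_suml.
  rewrite (eq_bigr (fun i : 'I_n => - f`_i * x ^+ (i + (d - n)))); last first.
    by move=> i _; rewrite -mulrA -exprD.
  rewrite subnKC//.
  apply: (@span_sum _ _ _ (fun i : 'I_d => x ^+ i)) => i.
    by rewrite rpredN (polyOverP fF).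
  have ltd : (i + (d - n) < d)%N by rewrite -{2}(subnKC nd) ltn_add2r.
  exact: (@span_gen _ _ (fun i : 'I_d => x ^+ i) (Ordinal ltd)).
elim: k => [|k [c [cF IHk]]].
  case: d nd xd => [|d] nd xd; first exact: xd.
  exact: (@span_gen _ _ (fun i : 'I_d.+1 => x ^+ i) ord0).
rewrite exprS IHk mulr_sumr.
rewrite (eq_bigr (fun i : 'I_d => c i * x ^+ i.+1)); last first.
  by move=> i _; rewrite mulrA -(centerP _ (cF i)) -mulrA -exprS.
apply: span_sum => // i; have [ltid|] := ltnP i.+1 d.
  exact: (@span_gen _ _ (fun i : 'I_d => x ^+ i) (Ordinal ltid)).
move=> dle; have -> : i.+1 = d by apply/eqP; rewrite eqn_leq dle ltn_ord.
exact: xd.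
Qed.

Lemma finite_center_exponent (N : D -> Prop) d : unit_subgroup N ->
  (forall x, N x -> exists2 n, (n <= d)%N & algebraic_of_degree x n) ->
  exists n, n%:R != 0 :> D /\ forall x, N x -> x ^+ n = 1.
Proof.
move=> gN alg; have [p pD] := finite_center_pchar.
have [fs Fs] := (@finite_seqP _ _).1 Ffin.
pose C := {ffun 'I_d -> seq_sub fs}.
have tor x : N x -> x ^+ (#|C|)`! = 1.
  move=> Nx; have [n nd xn] := alg x Nx.
  have ux : x \is a GRing.unit by apply: divD; case: gN => _ _ _; apply.
  have /choice[g gE] : forall k, exists c : C, x ^+ k = \sum_i val (c i) * x ^+ i.
    move=> k; have [c [cF ->]] := algebraic_span k nd xn.
    have cfs i : c i \in fs.
  by have : [set t | t \in F] (c i) := cF i; rewrite Fs.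
    exists [ffun i => SeqSub (cfs i)].
    by apply: eq_bigr => i _; rewrite ffunE.
  have [i [j [ij jC gij]]] := pigeonhole_nat g.
  have xji : x ^+ (j - i) = 1.
    apply: (mulrI (unitrX i ux)); rewrite mulr1 -exprD subnKC ?(ltnW ij)//.
    by rewrite gE -gij -gE.
  have /dvdnP[q ->] : (j - i %| (#|C|)`!)%N.
    by rewrite dvdn_fact// subn_gt0 ij (leq_trans (leq_subr _ _)).
  by rewrite mulnC exprM xji expr1n.
have [m cpm EM] := pfactor_coprime (pcharf_prime pD) (fact_gt0 #|C|).
exists m; split; first by rewrite -(dvdn_pcharf pD) -prime_coprime// (pcharf_prime pD).
move=> x Nx; apply: (@frobenius_root1 p (logn p (#|C|)`!) _ pD).
by rewrite -exprM -EM tor.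
Qed.

End FiniteCenter.

(** * Finite centre: finite subrings and centralizers *)

Section TwistedSubrings.
Local Open Scope ring_scope.
Local Open Scope classical_set_scope.
Variable D : unitRingType.
Hypothesis divD : GRing.field_axiom D.
Local Notation F := (center D).

Lemma span_inv (I : finType) (e : I -> D) (s : seq D) x :
  (forall y, span e y -> y \in s) -> (forall i j, span e (e i * e j)) ->
  span e 1 -> span e x -> span e x^-1.
Proof.
move=> es ee e1 ex.
have eX k : span e (x ^+ k) by elim: k => // k IHk; rewrite exprS; apply: spanM.
have [x0|/divD ux] := eqVneq x 0; first by rewrite x0 invr0; apply: span0.
have [i [j [ij _ /(congr1 val) /= gij]]] :=
  pigeonhole_nat (fun k => SeqSub (es _ (eX k)) : seq_sub s).
have xji : x * x ^+ (j - i.+1) = 1.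
  apply: (mulrI (unitrX i ux)).
  by rewrite -exprS -subSn// subSS -exprD subnKC ?(ltnW ij)// mulr1.
suff -> : x^-1 = x ^+ (j - i.+1) by [].
by rewrite -[RHS](mulKr ux) xji mulr1.
Qed.

(** The twist makes the F-span of the monomials w^x a^y a ring; being finite, it is a division ring,
    commutative by Wedderburn. *)
Lemma twisted_torsion_commute (a w : D) m n j :
  finite_set [set t | t \in F] ->
  (0 < m)%N -> (0 < n)%N -> a ^+ m = 1 -> w ^+ n = 1 ->
  a * w = w * a ^+ j -> a * w = w * a.
Proof.
move=> Ffin m0 n0 am wn aw.
pose e (k : 'I_n * 'I_m) := w ^+ k.1 * a ^+ k.2.
have span_e x y : span e (w ^+ x * a ^+ y).
  rewrite -(expr_mod x wn) -(expr_mod y am).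
  exact: (span_gen e (Ordinal (ltn_pmod x n0), Ordinal (ltn_pmod y m0))).
have awX y x : a ^+ y * w ^+ x = w ^+ x * a ^+ (y * j ^ x).
  elim: x y => [|x IHx] y; first by rewrite expr0 expn0 mulr1 mul1r muln1.
  have aw1 : a ^+ y * w = w * a ^+ (j * y).
    elim: y => [|y IHy]; first by rewrite muln0 mul1r mulr1.
    by rewrite exprSr -mulrA aw mulrA IHy -mulrA -exprD mulnS addnC.
  by rewrite exprS mulrA aw1 -mulrA IHx mulrA expnS mulnA (mulnC j).
have ee i k : span e (e i * e k).
  rewrite /e -mulrA (mulrA (a ^+ i.2)) awX !mulrA -exprD -mulrA -exprD.
  exact: span_e.
have e1 : span e 1 by have := span_e 0%N 0%N; rewrite mulr1.
have [s es] := finite_center_span Ffin e.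
pose K : {pred D} := [pred x | `[< span e x >]].
have KD : divring_closed K.
  split=> [|x y /asboolP ex /asboolP ey|x y /asboolP ex /asboolP ey].
  - exact/asboolP.
  - by apply/asboolP/spanB.
  - by apply/asboolP/spanM => //; apply: span_inv es _ _ _.
have sK x : x \in K -> x \in s by move=> /asboolP/es.
apply: (wedderburn KD divD sK); apply/asboolP.
  by have := span_e 0%N 1%N; rewrite mul1r.
by have := span_e 1%N 0%N; rewrite mulr1.
Qed.

Lemma chain_restrict (K : {pred D}) (KD : divring_closed K)
    (S : nat -> D -> Prop) r : almost_subnormal_chain S r ->
  almost_subnormal_chain (fun i (x : division_subring KD) => S i (val x)) r.
Proof.
move=> [gS S0 step]; split=> [i|x x0|i ir].
- have [S1 SM SV Sn0] := gS i; split=> [|x y|x|x].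
  + exact: S1.
  + exact: SM.
  + exact: SV.
  + by move=> /Sn0; apply: contraNneq => ->.
- by apply: S0; apply: contraNneq x0 => x0; apply/eqP/val_inj.
- have [sub [cj|[C [chi Hchi]]]] := step i ir.
    split=> [x|]; first exact: sub.
    by left=> a y Sa Sy; apply: cj.
  split=> [x|]; first exact: sub.
  by right; exists C, (chi \o val) => x y Sx Sy /= cxy; apply: Hchi.
Qed.

Lemma finite_center_false (S : nat -> D -> Prop) r d a :
  finite_set [set t | t \in F] -> almost_subnormal_chain S r ->
  (forall x, S r x -> exists2 n, (n <= d)%N & algebraic_of_degree x n) ->
  S r a -> a \notin F -> False.
Proof.
move=> Ffin cS alg Sa aF; have [gS _ _] := cS.
have [n [n0 tor]] := finite_center_exponent divD Ffin (gS r) alg.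
have ex : exists m, (0 < m)%N && (a ^+ m == 1).
  exists n; rewrite tor// eqxx andbT lt0n.
  by apply: contraNneq n0 => ->.
case: (ex_minnP ex) => m /andP[m0 /eqP am] mmin.
have amin k : (0 < k < m)%N -> a ^+ k != 1.
  move=> /andP[k0 km]; apply/negP => ak.
  by have := mmin k; rewrite k0 ak leqNgt km => /(_ isT).
have [j [w [w0 aw aj]]] := twisted_eigenvector divD m0 am amin aF.
have uw := divD w0.
have nc : a * w <> w * a.
  by rewrite aw => /(mulrI uw) E; rewrite E eqxx in aj.
have awX x : a * w ^+ x = w ^+ x * a ^+ (j ^ x).
  elim: x => [|x IHx]; first by rewrite mulr1 mul1r.
  have aw1 y : a ^+ y * w = w * a ^+ (j * y).
    elim: y => [|y IHy]; first by rewrite muln0 mul1r mulr1.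
    by rewrite exprSr -mulrA aw mulrA IHy -mulrA -exprD mulnS addnC.
  by rewrite exprSr mulrA IHx -mulrA aw1 mulrA expnS.
(* Two powers of j agree modulo m, so w^k and w^l twist a alike and w^(l-k) commutes with a. *)
have [k [l [kl _ /(congr1 val) /= jkl]]] :=
  pigeonhole_nat (fun x => Ordinal (ltn_pmod (j ^ x) m0)).
pose z := w ^+ (l - k).
have az : a * z = z * a.
  have zk : z * w ^+ k = w ^+ l by rewrite -exprD subnK ?(ltnW kl).
  apply: (mulIr (unitrX k uw)); rewrite -!mulrA zk !awX mulrA zk.
  by rewrite -(expr_mod (j ^ l) am) -jkl expr_mod.
have wz : w * z = z * w by apply: commrX.
(* If z has finite order, so does w, and a would commute with w. Otherwise z generates an infinite
   central subgroup of its centralizer. *)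
have [[i [i0 zi]]|ztor] := pselect (exists i, (0 < i)%N /\ z ^+ i = 1).
  apply: nc; apply: (twisted_torsion_commute Ffin m0 _ am _ aw); last first.
    by rewrite -zi /z -exprM.
  by rewrite muln_gt0 subn_gt0 kl.
pose K : {pred D} := [pred x | x * z == z * x].
have KD : divring_closed K.
  split=> [|x y /eqP xz /eqP yz|x y /eqP xz /eqP yz]; apply/eqP.
  - by rewrite mul1r mulr1.
  - by rewrite mulrBl mulrBr xz yz.
  - by apply/commr_sym/commrM; [|apply: commrV]; apply: esym.
have zK : z \in K by apply/eqP.
have aK : a \in K by apply/eqP.
have wK : w \in K by apply/eqP.
pose E := division_subring KD.
pose z1 : E := Sub z zK; pose a1 : E := Sub a aK; pose w1 : E := Sub w wK.
have z1c : z1 \in center E.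
  by apply/centerP => y; apply/val_inj; have /eqP/esym := valP y.
have Einf : ~ finite_set [set t | t \in center E].
  move=> /finite_seqP[fs Fs].
  have z1F i : z1 ^+ i \in fs.
    by have : [set t | t \in center E] (z1 ^+ i) := rpredX i z1c; rewrite Fs.
  have [i [i' [ii' _ /(congr1 val) /= gii']]] :=
    pigeonhole_nat (fun i => SeqSub (z1F i) : seq_sub fs).
  apply: ztor; exists (i' - i)%N; rewrite subn_gt0; split=> //.
  have uz : z \is a GRing.unit by rewrite unitrX.
  apply: (mulrI (unitrX i uz)); rewrite mulr1 -exprD subnKC ?(ltnW ii')//.
  by have := congr1 val gii'; rewrite !val_division_subringX.
have /centerP/(_ w1)/(congr1 val) : a1 \in center E.
  apply: (torsion_chain_central (division_subring_field divD) Einf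
    (chain_restrict KD cS) (n := n)) => //.
    apply: contraNneq n0 => /(congr1 val).
    by rewrite val_division_subring_nat => ->.
  by move=> x Sx; apply/val_inj; rewrite val_division_subringX; apply: tor.
exact: nc.
Qed.

End TwistedSubrings.

(** * Combining the cases; from almost subnormal subgroups to chains *)

Section MainCase.
Local Open Scope ring_scope.
Local Open Scope classical_set_scope.
Variable D : unitRingType.
Hypothesis divD : GRing.field_axiom D.
Local Notation F := (center D).

Lemma algebraic_dep (x : D) n d : (n <= d)%N -> algebraic_of_degree x n ->
  ~ indep (fun i : 'I_d.+1 => x ^+ i).
Proof.
move=> nd [f [fm fF /rootP fx _] sf] ix.
have nd1 : (n < d.+1)%N by [].
have := ix (fun i => f`_i) (fun i => polyOverP fF i) _ (Ordinal nd1).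
rewrite /= -horner_coef_wide ?sf// => /(_ fx)/eqP.
have -> : f`_n = 1 by move: fm; rewrite monicE lead_coefE sf => /eqP.
by rewrite oner_eq0.
Qed.

Lemma indep_powersZ n t (x : D) : t \in F -> t != 0 ->
  indep (fun i : 'I_n => x ^+ i) -> indep (fun i : 'I_n => (t * x) ^+ i).
Proof.
move=> tF t0 ix c cF ce i.
suff: c i * t ^+ i = 0.
  move=> E; apply: (mulIr (unitrX i (divD t0))); rewrite mul0r; exact: E.
apply: (ix (fun i : 'I_n => c i * t ^+ i)) => [k|]; first by rewrite rpredM ?rpredX.
rewrite -[RHS]ce; apply: eq_bigr => k _.
by rewrite exprMn_comm ?mulrA//; apply: (centerP _ tF).
Qed.

Lemma chain_centrally_finite (S : nat -> D -> Prop) r d a :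
  almost_subnormal_chain S r ->
  (forall x, S r x -> exists2 n, (n <= d)%N & algebraic_of_degree x n) ->
  S r a -> a \notin F -> centrally_finite D.
Proof.
move=> cS alg Sa aF; apply: contrapT => ncf; have [gS _ _] := cS.
have [Ffin|Finf] := pselect (finite_set [set t | t \in F]).
  exact: finite_center_false Ffin cS alg Sa aF.
have [U [UU UF Une]] := generic_ultrafilter Finf.
have PU : ProperFilter U by apply: ultra_proper.
have [[b [Sb bF sb]]|nsep] :=
    pselect (exists b, [/\ S r b, b \notin F & separable b]).
  have ub : b \is a GRing.unit by apply: divD; case: (gS r) => _ _ _; apply.
  apply: (commutators_not_algebraic divD PU UF Une ncf (n := d) sb bF) => u.
  have [u' ->] := separable_ad_iter divD r u sb.
  (* The factor b^r turns iterates of ad b into iterates of delta_b, to which [chain_tangent]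
     applies. *)
  rewrite iterSr -iter_delta//.
  have [t [tF t0 tT]] := chain_tangent divD UU UF Une (ad b u' * b ^+ r) cS Sb.
  have := tangent_algebraic divD UU UF Une ncf _ tT => /(_ d) H iu.
  apply: H => [x Sx|]; first by have [n nd xn] := alg x Sx; apply: algebraic_dep xn.
  exact: indep_powersZ.
have sepF x : S r x -> separable x -> x \in F.
  move=> Sx sx; apply/negPn/negP => xF; apply: nsep.
  by exists x.
have [na _ an] := alg a Sa.
have [|p [pD _]] := inseparable_degree divD an.
  by move=> /(sepF a Sa); apply/negP.
have p_gt0 := prime_gt0 (pcharf_prime pD).
have rad := inseparable_power divD (gS r) pD alg sepF.
have ex : exists k, a ^+ (p ^ k) \in F by exists d; apply: rad.
case: (ex_minnP ex) => -[|k]; first by rewrite expr1 (negPf aF).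
(* Minimality of k + 1 makes b noncentral, with b^p in F. *)
rewrite expnSr exprM; set b := a ^+ (p ^ k) => bpF kmin.
have Sb : S r b by apply: unit_subgroupX.
have bF : b \notin F by apply/negP => /kmin; rewrite ltnn.
have b0 : b != 0 by case: (gS r) => _ _ _; apply.
have [u bu] := radical_translation divD pD bF bpF.
apply: (radical_chain_false divD PU UF Une b0 p_gt0 bpF bu cS Sb _ rad).
by rewrite expn_gt0 p_gt0.
Qed.

Lemma almost_subnormal_unit_chain (N : groupClosed (unit_group D)) :
  almost_subnormal N -> exists (S : nat -> D -> Prop) r,
    almost_subnormal_chain S r /\
    forall x, S r x <-> exists2 y : unit_group D, y \in N & val y = x.
Proof.
move=> [r [S [S0 Sr step]]].
pose S' i x := exists2 y : unit_group D, y \in S i & val y = x.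
have S'val i y : S' i (val y) -> y \in S i by move=> [z zS /val_inj <-].
exists S', r; split; last first.
  by move=> x; split=> -[y yS <-]; exists y => //; move: yS; rewrite Sr.
split.
- move=> i; split.
  + by exists 1%g => //; apply: gpred1.
  + move=> _ _ [x xS <-] [y yS <-]; exists (x * y)%g => //.
    exact: gpredM.
  + move=> _ [x xS <-]; exists (x^-1)%g => //.
    by rewrite gpredV.
  + move=> _ [x xS <-]; apply: contraTneq (valP x) => ->.
    by rewrite unitr0.
- move=> x /divD ux; exists (Sub x ux : unit_group D) => //.
- move=> i ir; have [[sub nrm]|[sub fin]] := step i ir; split.
  + by move=> _ [x xS <-]; exists x => //; apply: sub.
  (* In groups [h ^ k] is k^-1 h k, whereas chains conjugate as y a y^-1. *)
  + left=> _ _ [h hS <-] [k kS <-]; exists (h ^ (k^-1))%g.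
      by apply: nrm => //; rewrite gpredV.
    by rewrite conjgE invgK mulgA.
  + by move=> _ [x xS <-]; exists x => //; apply: sub.
  + right; have [cs Ecs] := (@finite_seqP _ _).1 fin.
    pose coset (x : unit_group D) := [set (x * h)%g | h in [set` S i.+1]].
    have csP x : x \in S i -> coset x \in cs.
      move=> xS; have : [set coset k | k in [set` S i]] (coset x) by exists x.
      by rewrite Ecs.
    (* Colours are left cosets; [None] occurs only outside [S i]. *)
    exists (option (seq_sub cs)).
    exists (fun x : D => if @insub D _ (unit_group D) x is Some y
      then @insub _ _ (seq_sub cs) (coset y) else None).
    move=> _ _ [x xS <-] [y yS <-]; rewrite !valK.
    case: insubP => [sx _ Esx|]; last by rewrite (csP x xS).
    case: insubP => [sy _ Esy|]; last by rewrite (csP y yS).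
    move=> [Exy]; have {}Exy : coset x = coset y by rewrite -Esx -Esy Exy.
    have : coset y y by exists 1%g; rewrite ?mulg1//=; apply: gpred1.
    rewrite -Exy => -[h hS <-]; exists h => //.
    by rewrite /= mulKr// (valP x).
Qed.

End MainCase.

Theorem corollary1p3 (D : unitRingType) (divD : GRing.field_axiom D)
    (N : groupClosed (unit_group D)) (asnN : almost_subnormal N)
    (ncN : ~ (forall x : unit_group D, x \in N -> val x \in center D))
    (d : nat) (d_gt0 : 0 < d)
    (algN : forall x : unit_group D, x \in N ->
       exists2 n : nat, n <= d & algebraic_of_degree (val x) n) :
  centrally_finite D.
Proof.
have [S [r [cS SN]]] := almost_subnormal_unit_chain divD asnN.
have [a aN aF] : exists2 a, a \in N & val a \notin center D.
  apply: contrapT => nex; apply: ncN => x xN.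
  by apply/negPn/negP => xF; apply: nex; exists x.
apply: (chain_centrally_finite divD cS (d := d) (a := val a)) => //.
  by move=> x /SN[y yN <-]; apply: algN.
by apply/SN; exists a.
Qed.
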